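(* Let $(\mathcal{J},\circ)$ be a Euclidean Jordan algebra with underlying vector space $\mathbb{R}^d$, with cone of squares $\mathcal{K}$ and canonical inner product $\langle x,y\rangle=\mathrm{tr}(x\circ y)$. Let $X\in\mathbb{R}^{m\times n}$ be an entrywise nonnegative matrix with no zero row and no zero column. Let $a_1^{0},\dots,a_m^{0},b_1^{0},\dots,b_n^{0}\in\mathrm{int}(\mathcal{K})$ and define iterates for $t\ge 0$ by $$a_i^{t+1}=P\big(a_i^{t}\#(\mathcal{B}_t^{T}\mathcal{B}_ta_i^{t})^{-1}\big)\mathcal{B}_t^{T}X_{i:}\quad(1\le i\le m),\qquad b_j^{t+1}=P\big(b_j^{t}\#(\mathcal{A}_{t+1}^{T}\mathcal{A}_{t+1}b_j^{t})^{-1}\big)\mathcal{A}_{t+1}^{T}X_{:j}\quad(1\le j\le n),$$ where $\mathcal{B}_ty=(\langle b_1^t,y\rangle,\dots,\langle b_n^t,y\rangle)^{T}$ and $\mathcal{A}_ty=(\langle a_1^t,y\rangle,\dots,\langle a_m^t,y\rangle)^{T}$ for $y\in\mathbb{R}^d$. Then all iterates are well defined and lie in $\mathrm{int}(\mathcal{K})$, and the squared loss is non-increasing along the iterates: for all $t\ge0$, $$\sum_{i=1}^m\sum_{j=1}^n\big(X_{ij}-\langle a_i^{t+1},b_j^{t+1}\rangle\big)^2\le\sum_{i=1}^m\sum_{j=1}^n\big(X_{ij}-\langle a_i^{t},b_j^{t}\rangle\big)^2 .$$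
   Context: A Jordan algebra is a finite-dimensional real vector space $\mathcal{J}$ with a bilinear product $\circ$ satisfying $x\circ y=y\circ x$ and $x^2\circ(x\circ y)=x\circ(x^2\circ y)$, where $x^2=x\circ x$; it is assumed to have an identity element $e$. It is Euclidean (an EJA) if it admits an inner product $(\cdot,\cdot)$ with $(x\circ y,z)=(y,x\circ z)$ for all $x,y,z$. An idempotent is an element $c$ with $c^2=c$; it is primitive if it is nonzero and is not a sum of two nonzero idempotents. A Jordan frame is a family $c_1,\dots,c_r$ of primitive idempotents with $c_i\circ c_j=0$ for $i\ne j$ and $\sum_i c_i=e$. Every $x\in\mathcal{J}$ can be written $x=\sum_{j=1}^r\lambda_jc_j$ for some Jordan frame and reals $\lambda_j$ (the eigenvalues of $x$, unique up to order, counted with multiplicity). One sets $\mathrm{tr}(x)=\sum_j\lambda_j$, and $x^{\alpha}=\sum_j\lambda_j^{\alpha}c_j$ whenever all $\lambda_j^\alpha$ are defined (in particular $x^{-1}$ and $x^{1/2}$). The canonical inner product is $\langle x,y\rangle=\mathrm{tr}(x\circ y)$. The cone of squares is $\mathcal{K}=\{x^2:x\in\mathcal{J}\}$; symmetric cones (self-dual homogeneous cones) are exactly the cones of squares of EJAs. With $L(x)y=x\circ y$, the quadratic representation of $x$ is the linear operator $P(x)=2L(x)^2-L(x^2)$. For $x,y\in\mathrm{int}(\mathcal{K})$ the geometric mean is $x\#y=P(x^{1/2})\big(P(x^{-1/2})y\big)^{1/2}\in\mathrm{int}(\mathcal{K})$. Adjoints $(\cdot)^{T}$ are taken with respect to $\langle\cdot,\cdot\rangle$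 on $\mathbb{R}^d=\mathcal{J}$ and the standard inner products on $\mathbb{R}^m,\mathbb{R}^n$; thus $\mathcal{A}_t^{T}y=\sum_iy_ia_i^t$ and $\mathcal{B}_t^{T}y=\sum_jy_jb_j^t$. $X_{i:}\in\mathbb{R}^n$ and $X_{:j}\in\mathbb{R}^m$ denote the $i$-th row and $j$-th column of $X$, viewed as vectors. The iteration is the symmetric-cone multiplicative update (SCMU) algorithm. *)

(* Defs.v *)
From HB Require Import structures.
From mathcomp Require Import all_boot all_order all_algebra.
From mathcomp Require Import all_classical all_reals all_analysis.

Set Implicit Arguments.
Unset Strict Implicit.
Unset Printing Implicit Defensive.

Import Order.TTheory GRing.Theory Num.Theory.
Import numFieldNormedType.Exports.

Local Open Scope classical_set_scope.
Local Open Scope ring_scope.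

(* R^k is 'rV[R]_k throughout. *)
Record jordanAlgebra (R : realType) (d : nat) := JordanAlgebra {
  jmul : 'rV[R]_d -> 'rV[R]_d -> 'rV[R]_d;
  junit : 'rV[R]_d;
  jmul_linearl : forall y, linear (fun x => jmul x y);
  jmul_linearr : forall x, linear (jmul x);
  jmulC : forall x y, jmul x y = jmul y x;
  jmul_jordan : forall x y,
    jmul (jmul x x) (jmul x y) = jmul x (jmul (jmul x x) y);
  jmul1 : forall x, jmul junit x = x
}.

Definition euclidean (R : realType) (d : nat) (J : jordanAlgebra R d) : Prop :=
  exists ip : 'rV[R]_d -> 'rV[R]_d -> R,
    [/\ forall y, scalar (fun x => ip x y),
        forall x y, ip x y = ip y x,
        forall x, x != 0 -> 0 < ip x x
      & forall x y z, ip (jmul J x y) z = ip y (jmul J x z)].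

Definition jsqr (R : realType) (d : nat) (J : jordanAlgebra R d)
  (x : 'rV[R]_d) : 'rV[R]_d := jmul J x x.

Definition jidempotent (R : realType) (d : nat) (J : jordanAlgebra R d)
  (c : 'rV[R]_d) : Prop := jsqr J c = c.

Definition primitive_idempotent (R : realType) (d : nat)
    (J : jordanAlgebra R d) (c : 'rV[R]_d) : Prop :=
  [/\ jidempotent J c, c != 0
    & ~ exists c1 c2, [/\ jidempotent J c1, jidempotent J c2,
                          c1 != 0, c2 != 0 & c = c1 + c2]].

Definition jordan_frame (R : realType) (d : nat) (J : jordanAlgebra R d)
    (r : nat) (c : 'I_r -> 'rV[R]_d) : Prop :=
  [/\ forall i, primitive_idempotent J (c i),
      forall i j, i != j -> jmul J (c i) (c j) = 0
    & \sum_(i < r) c i = junit J].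

Definition spectral_decomposition (R : realType) (d : nat)
    (J : jordanAlgebra R d) (x : 'rV[R]_d) (r : nat)
    (c : 'I_r -> 'rV[R]_d) (l : 'I_r -> R) : Prop :=
  jordan_frame J c /\ x = \sum_(j < r) l j *: c j.

Definition is_trace (R : realType) (d : nat) (J : jordanAlgebra R d)
    (x : 'rV[R]_d) (s : R) : Prop :=
  exists (r : nat) (c : 'I_r -> 'rV[R]_d) (l : 'I_r -> R),
    spectral_decomposition J x c l /\ s = \sum_(j < r) l j.

(* The value does not depend on the chosen spectral decomposition when J is
   euclidean. *)
Definition jtr (R : realType) (d : nat) (J : jordanAlgebra R d)
  (x : 'rV[R]_d) : R := xget 0 [set s | is_trace J x s].

Definition jdot (R : realType) (d : nat) (J : jordanAlgebra R d)
  (x y : 'rV[R]_d) : R := jtr J (jmul J x y).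

(* The set of (l, alpha) for which the real power l^alpha is defined: a
   negative l needs an integer alpha, and 0 needs alpha >= 0. *)
Definition rpow_dom (R : realType) (l alpha : R) : Prop :=
  [\/ 0 < l, l = 0 /\ 0 <= alpha | l < 0 /\ alpha \is a Num.int].

(* powR is only meaningful for a nonnegative base; on rpow_dom, a negative l
   comes with an integer alpha, which is its own floor. *)
Definition rpow (R : realType) (l alpha : R) : R :=
  if 0 <= l then l `^ alpha else l ^ Num.floor alpha.

Definition is_jpow (R : realType) (d : nat) (J : jordanAlgebra R d)
    (x : 'rV[R]_d) (alpha : R) (y : 'rV[R]_d) : Prop :=
  exists (r : nat) (c : 'I_r -> 'rV[R]_d) (l : 'I_r -> R),
    [/\ spectral_decomposition J x c l,
        forall j, rpow_dom (l j) alpha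
      & y = \sum_(j < r) rpow (l j) alpha *: c j].

Definition jpow_defined (R : realType) (d : nat) (J : jordanAlgebra R d)
  (x : 'rV[R]_d) (alpha : R) : Prop := exists! y, is_jpow J x alpha y.

(* Junk value 0 when x^alpha is undefined. *)
Definition jpow (R : realType) (d : nat) (J : jordanAlgebra R d)
  (x : 'rV[R]_d) (alpha : R) : 'rV[R]_d := xget 0 [set y | is_jpow J x alpha y].

Definition jcone (R : realType) (d : nat) (J : jordanAlgebra R d) :
  set 'rV[R]_d := [set jsqr J x | x in setT].

Definition quad_rep (R : realType) (d : nat) (J : jordanAlgebra R d)
    (x y : 'rV[R]_d) : 'rV[R]_d :=
  2 *: jmul J x (jmul J x y) - jmul J (jsqr J x) y.

Definition geomean (R : realType) (d : nat) (J : jordanAlgebra R d)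
    (x y : 'rV[R]_d) : 'rV[R]_d :=
  quad_rep J (jpow J x (1 / 2))
    (jpow J (quad_rep J (jpow J x (- (1 / 2))) y) (1 / 2)).

Definition geomean_defined (R : realType) (d : nat) (J : jordanAlgebra R d)
    (x y : 'rV[R]_d) : Prop :=
  [/\ interior (jcone J) x,
      interior (jcone J) y,
      jpow_defined J x (1 / 2),
      jpow_defined J x (- (1 / 2))
    & jpow_defined J (quad_rep J (jpow J x (- (1 / 2))) y) (1 / 2)].

(* For a family u_1, ..., u_k in J: the operator y |-> (<u_i, y>)_i from J to
   R^k, and its adjoint for <.,.> and the standard inner product of R^k. *)
Definition fam_op (R : realType) (d : nat) (J : jordanAlgebra R d) (k : nat)
  (u : 'I_k -> 'rV[R]_d) (y : 'rV[R]_d) : 'rV[R]_k := \row_i jdot J (u i) y.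

Definition fam_adj (R : realType) (d : nat) (k : nat)
    (u : 'I_k -> 'rV[R]_d) (y : 'rV[R]_k) : 'rV[R]_d :=
  \sum_(i < k) y 0 i *: u i.

(* P(a # (U^T U a)^-1) U^T v, with U the operator of the family u. *)
Definition scmu_update (R : realType) (d : nat) (J : jordanAlgebra R d)
    (k : nat) (u : 'I_k -> 'rV[R]_d) (a : 'rV[R]_d) (v : 'rV[R]_k) :
    'rV[R]_d :=
  quad_rep J (geomean J a (jpow J (fam_adj u (fam_op J u a)) (- 1)))
    (fam_adj u v).

Definition scmu_update_defined (R : realType) (d : nat)
    (J : jordanAlgebra R d) (k : nat) (u : 'I_k -> 'rV[R]_d)
    (a : 'rV[R]_d) : Prop :=
  jpow_defined J (fam_adj u (fam_op J u a)) (- 1) /\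
  geomean_defined J a (jpow J (fam_adj u (fam_op J u a)) (- 1)).

Definition scmu_step (R : realType) (d : nat) (J : jordanAlgebra R d)
    (m n : nat) (X : 'M[R]_(m, n))
    (ab : ('I_m -> 'rV[R]_d) * ('I_n -> 'rV[R]_d)) :
    ('I_m -> 'rV[R]_d) * ('I_n -> 'rV[R]_d) :=
  let a' := fun i => scmu_update J ab.2 (ab.1 i) (row i X) in
  let b' := fun j => scmu_update J a' (ab.2 j) (col j X)^T in
  (a', b').

Definition scmu (R : realType) (d : nat) (J : jordanAlgebra R d)
    (m n : nat) (X : 'M[R]_(m, n)) (a0 : 'I_m -> 'rV[R]_d)
    (b0 : 'I_n -> 'rV[R]_d) (t : nat) :
    ('I_m -> 'rV[R]_d) * ('I_n -> 'rV[R]_d) :=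
  iter t (scmu_step J X) (a0, b0).

Definition sq_loss (R : realType) (d : nat) (J : jordanAlgebra R d)
    (m n : nat) (X : 'M[R]_(m, n)) (a : 'I_m -> 'rV[R]_d)
    (b : 'I_n -> 'rV[R]_d) : R :=
  \sum_(i < m) \sum_(j < n) (X i j - jdot J (a i) (b j)) ^+ 2.

(* Main.v *)
(** Everything is derived for an arbitrary associative inner product on the
    algebra. If b and c are primitive with (b, c) <> 0 then the fundamental
    formula P(P(x)y) = P(x)P(y)P(x) forces (b, b) = (c, c), so that for a Jordan
    frame c_1, ..., c_r the linear form x |-> sum_i (x, c_i) / (c_i, c_i) takes
    the value 1 at every primitive idempotent. Hence it is the trace, the trace
    is linear, and <x, y> = tr(x o y) is itself an associative inner product.

    For the update of one vector a, put Q = U^T U, z = Q a and w = a # z^-1, so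
    that P(w) z = a. Conjugating Q by P(w^(1/2)) yields a positive semidefinite
    operator that preserves the cone and fixes the interior point P(w^(-1/2)) a,
    so by a Perron-Frobenius argument it is at most the identity, that is
    Q <= P(w)^-1. The squared loss is therefore majorized by the quadratic
    function with Hessian 2 P(w)^-1, whose minimizer is the updated vector. *)

Require Import Defs.
From HB Require Import structures.
From mathcomp Require Import all_boot all_order all_algebra.
From mathcomp Require Import all_classical all_reals all_analysis.
From mathcomp Require Import ring lra.
From mathcomp Require Import complex.

Set Implicit Arguments.
Unset Strict Implicit.
Unset Printing Implicit Defensive.

Import Order.TTheory GRing.Theory Num.Theory.
Import numFieldNormedType.Exports.

Local Open Scope classical_set_scope.
Local Open Scope ring_scope.

(** * Jordan identities and the fundamental formula *)

(** Products act as atoms: a linear consequence of vector equations is checked in each coordinate by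
    linear arithmetic. *)
Ltac rowlra :=
  let k := fresh "k" in
  apply/rowP => k;
  repeat match goal with
  | H : @eq _ _ _ |- _ =>
      let H' := fresh in
      have H' := congr1 (fun v : matrix _ 1 _ => v 0 k) H; clear H;
        rewrite ?mxE in H'
  end;
  rewrite ?mxE; lra.

(* Orients the products occurring in the goal: whenever both [a b] and [b a]
   occur, the latter is rewritten into the former. *)
Ltac jcomm :=
  repeat match goal with
  | |- context [jmul ?J ?a ?b] =>
      match goal with
      | |- context [jmul J b a] =>
          tryif constr_eq a b then fail else rewrite (jmulC J b a)
      end
  end.

Section JordanIdentities.
Variables (R : realType) (d : nat) (J : jordanAlgebra R d).
Implicit Types x y z u v w : 'rV[R]_d.

Local Notation "x ∘ y" := (jmul J x y) (at level 40, left associativity).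
Local Notation e := (junit J).

Lemma jmulDl x y z : (x + y) ∘ z = x ∘ z + y ∘ z.
Proof. by have := jmul_linearl J z 1 x y; rewrite /= !scale1r. Qed.

Lemma jmulDr x y z : z ∘ (x + y) = z ∘ x + z ∘ y.
Proof. by rewrite jmulC jmulDl !(jmulC J z). Qed.

Lemma jmul0l x : 0 ∘ x = 0.
Proof. by apply: (@addIr _ (0 ∘ x)); rewrite -jmulDl !add0r. Qed.

Lemma jmul0r x : x ∘ 0 = 0.
Proof. by rewrite jmulC jmul0l. Qed.

Lemma jmulZl a x z : (a *: x) ∘ z = a *: (x ∘ z).
Proof. by have := jmul_linearl J z a x 0; rewrite /= !addr0 jmul0l addr0. Qed.

Lemma jmulZr a x z : z ∘ (a *: x) = a *: (z ∘ x).
Proof. by rewrite jmulC jmulZl jmulC. Qed.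

Lemma jmulNl x z : (- x) ∘ z = - (x ∘ z).
Proof. by rewrite -scaleN1r jmulZl scaleN1r. Qed.

Lemma jmulNr x z : z ∘ (- x) = - (z ∘ x).
Proof. by rewrite jmulC jmulNl jmulC. Qed.

Lemma jmulBl x y z : (x - y) ∘ z = x ∘ z - y ∘ z.
Proof. by rewrite jmulDl jmulNl. Qed.

Lemma jmulBr x y z : z ∘ (x - y) = z ∘ x - z ∘ y.
Proof. by rewrite jmulDr jmulNr. Qed.

Lemma jmul1r x : x ∘ e = x.
Proof. by rewrite jmulC jmul1. Qed.

Lemma jmul_suml I (s : seq I) (P : pred I) (F : I -> 'rV[R]_d) z :
  (\sum_(i <- s | P i) F i) ∘ z = \sum_(i <- s | P i) F i ∘ z.
Proof.
exact: (big_morph (fun x => x ∘ z) (fun x y => jmulDl x y z) (jmul0l z)).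
Qed.

Lemma jmul_sumr I (s : seq I) (P : pred I) (F : I -> 'rV[R]_d) z :
  z ∘ (\sum_(i <- s | P i) F i) = \sum_(i <- s | P i) z ∘ F i.
Proof. by rewrite jmulC jmul_suml; apply: eq_bigr => i _; rewrite jmulC. Qed.

Let jE := (jmulDl, jmulDr, jmulBl, jmulBr, jmulNl, jmulNr, jmulZl, jmulZr).

(** The Jordan identity is cubic in its first variable. The difference of its instances at x + z and
    x - z, less twice the one at z, leaves the component quadratic in x and linear in z. *)
Lemma jordan_lin1 x z y :
  2 *: ((x ∘ z) ∘ (x ∘ y)) + (x ∘ x) ∘ (z ∘ y) =
  z ∘ ((x ∘ x) ∘ y) + 2 *: (x ∘ ((x ∘ z) ∘ y)).
Proof.
have := jmul_jordan J z y; have := jmul_jordan J (x - z) y.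
have := jmul_jordan J (x + z) y; rewrite !jE; jcomm => *; rowlra.
Qed.

(* The left-hand side is symmetric in all four variables, so [y] can be traded
   for any of [x], [u], [z] on the right-hand side. *)
Lemma jordan_lin x u z y :
  (x ∘ z) ∘ (u ∘ y) + (u ∘ z) ∘ (x ∘ y) + (x ∘ u) ∘ (z ∘ y) =
  z ∘ ((x ∘ u) ∘ y) + x ∘ ((u ∘ z) ∘ y) + u ∘ ((x ∘ z) ∘ y).
Proof.
have := jordan_lin1 u z y; have := jordan_lin1 x z y.
have := jordan_lin1 (x + u) z y; rewrite !jE; jcomm => *; rowlra.
Qed.

(** The commutator of L(x) and L(y), an inner derivation by [jderM]. *)
Definition jder x y z := x ∘ (y ∘ z) - y ∘ (x ∘ z).

Lemma jderM x y z w : jder x y (z ∘ w) = jder x y z ∘ w + z ∘ jder x y w.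
Proof.
have := jordan_lin y w z x; have := jordan_lin x w z y.
by rewrite /jder !jE; jcomm => *; rowlra.
Qed.

(** The Jordan triple product, which polarizes P. As an operator on z it is L(x ∘ y) +
    [L(x), L(y)]. *)
Definition jtriple x y z := (x ∘ y) ∘ z + jder x y z.

Local Notation "{ x | y | z }" := (jtriple x y z).

Lemma jtripleDl x x' y z : {x + x' | y | z} = {x | y | z} + {x' | y | z}.
Proof. by rewrite /jtriple /jder !jE; rowlra. Qed.

Lemma jtripleDm x y y' z : {x | y + y' | z} = {x | y | z} + {x | y' | z}.
Proof. by rewrite /jtriple /jder !jE; rowlra. Qed.

Lemma jtripleDr x y z z' : {x | y | z + z'} = {x | y | z} + {x | y | z'}.
Proof. by rewrite /jtriple /jder !jE; rowlra. Qed.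

Lemma jtripleZm a x y z : {x | a *: y | z} = a *: {x | y | z}.
Proof. by rewrite /jtriple /jder !jE; rowlra. Qed.

Lemma jtripleBm x y y' z : {x | y - y' | z} = {x | y | z} - {x | y' | z}.
Proof. by rewrite -scaleN1r jtripleDm jtripleZm scaleN1r. Qed.

Lemma jtripleC x y z : {x | y | z} = {z | y | x}.
Proof. by rewrite /jtriple /jder; jcomm; rowlra. Qed.

Lemma quad_repE x y : quad_rep J x y = {x | y | x}.
Proof. by rewrite /quad_rep /jtriple /jder /jsqr; jcomm; rowlra. Qed.

Lemma derivation_triple (f : 'rV[R]_d -> 'rV[R]_d) u v w :
    (forall a b, f (a + b) = f a + f b) ->
      (forall a b, f (a - b) = f a - f b) ->
    (forall a b, f (a ∘ b) = f a ∘ b + a ∘ f b) ->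
  f {u | v | w} = {f u | v | w} + {u | f v | w} + {u | v | f w}.
Proof.
by move=> fD fB fM; rewrite /jtriple /jder fD fB !fM !jE; rowlra.
Qed.

Lemma jmul_triple a u v w :
  a ∘ {u | v | w} = {a ∘ u | v | w} - {u | a ∘ v | w} + {u | v | a ∘ w}.
Proof.
have := jderM u v a w; have := jordan_lin a u v w.
rewrite /jtriple /jder !jE; jcomm => *; rowlra.
Qed.

(** The derivation part of the outer operator obeys the Leibniz rule, and the part L(x ∘ y) obeys it
    with a minus sign in the middle slot ([jmul_triple]). Flipping that sign turns the operator of
    (x, y) into minus the one of (y, x). *)
Lemma jtriple_triple x y u v w :
  {x | y | {u | v | w}} =
  {{x | y | u} | v | w} - {u | {y | x | v} | w} + {u | v | {x | y | w}}.
Proof.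
have yxE : {y | x | v} = (x ∘ y) ∘ v - jder x y v.
  by rewrite /jtriple /jder; jcomm; rowlra.
have der := @derivation_triple (jder x y) u v w.
rewrite yxE (_ : {x | y | {u | v | w}} =
  (x ∘ y) ∘ {u | v | w} + jder x y {u | v | w}) //.
rewrite jmul_triple der; last first.
- exact: jderM.
- by move=> a b; rewrite /jder !jE; rowlra.
- by move=> a b; rewrite /jder !jE; rowlra.
rewrite (_ : {x | y | u} = (x ∘ y) ∘ u + jder x y u) //.
rewrite (_ : {x | y | w} = (x ∘ y) ∘ w + jder x y w) //.
by rewrite jtripleDl jtripleBm jtripleDr; rowlra.
Qed.

(** Write A and B for the two left-hand sides and C for the common right-hand side. The
    five-variable identity gives A = 2B - C and B = 2A - C, hence A = B = C. *)
Lemma quad_rep_triple x y z :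
  ({x | y | quad_rep J x z} = quad_rep J x {y | x | z}) *
  ({x | z | quad_rep J x y} = quad_rep J x {y | x | z}).
Proof.
have H1 := jtriple_triple x y x z x.
have H2 := jtriple_triple x z x y x.
rewrite (jtripleC z x y) in H2; rewrite !quad_repE.
rewrite [{{x | _ | x} | _ | x}]jtripleC in H1.
rewrite [{{x | _ | x} | _ | x}]jtripleC in H2.
by split; rowlra.
Qed.

Lemma quad_rep_triple_swap x y z :
  {quad_rep J x y | y | z} = {x | quad_rep J y x | z}.
Proof.
by have := jtriple_triple x y x y z; rewrite !quad_repE => H; rowlra.
Qed.

(* The derivation from the triple product identity follows Loos, Jordan Pairs,
   Section 2. *)
Theorem quad_rep_fundamental x y z :
  quad_rep J (quad_rep J x y) z = quad_rep J x (quad_rep J y (quad_rep J x z)).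
Proof.
(* Applying P(x) to this formula gives the right-hand side of the theorem; [H1] expands the
   left-hand side into the same two terms. *)
have half : quad_rep J y (quad_rep J x z) =
    2 *: {y | x | {y | x | z}} - {y | quad_rep J x y | z}.
  have := jtriple_triple z x y x y.
  rewrite -!quad_repE (jtripleC z x y) [{_ | x | y}]jtripleC.
  rewrite -quad_rep_triple_swap [{quad_rep J _ _ | _ | _}]jtripleC => H; rowlra.
set a := quad_rep J x y.
have H1 : {a | z | {x | y | x}} = {{a | z | x} | y | x} - {x | {z | a | y} | x}
  +
   {x | y | {a | z | x}} by exact: jtriple_triple.
have H2 : {a | z | x} = quad_rep J x {y | x | z}.
  by rewrite jtripleC (quad_rep_triple x y z).2.
rewrite -!quad_repE -/a -?quad_repE H2 [{_ | y | x}]jtripleC in H1.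
rewrite (quad_rep_triple _ _ _).1 [{z | a | y}]jtripleC in H1.
have quadB v w : quad_rep J x (v - w) = quad_rep J x v - quad_rep J x w.
  by rewrite !quad_repE jtripleBm.
have quadZ v : quad_rep J x (2 *: v) = 2 *: quad_rep J x v.
  by rewrite !quad_repE jtripleZm.
by rewrite H1 half quadB quadZ -/a scaler_nat mulr2n addrAC.
Qed.

(** L(c) is a root of t(t - 1)(2t - 1), which is the source of the Peirce eigenvalues 0, 1/2 and
    1. *)
Lemma idem_quad (c : 'rV[R]_d) x : c ∘ c = c ->
  2 *: (c ∘ (c ∘ (c ∘ x))) = 3 *: (c ∘ (c ∘ x)) - c ∘ x.
Proof.
move=> cc; have := jordan_lin1 c x c; rewrite !cc (jmulC J x c).
by rewrite !(jmulC J (c ∘ x) c) => H; rowlra.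
Qed.

Lemma orth_idem_comm c u x : c ∘ c = c -> c ∘ u = 0 ->
  c ∘ (u ∘ x) = u ∘ (c ∘ x).
Proof.
move=> cc cu; have := jordan_lin c c u x.
rewrite cc cu !jmul0l jmul0r => H; rowlra.
Qed.

(** * Powers and inverses of a single element *)

Fixpoint jexp x n := if n is m.+1 then x ∘ jexp x m else e.

(** The linearized identity expresses L(x^(n+2)) through L(x), L(x^2), L(x^(n+1)) and L(x^n), and
    L(x) commutes with L(x^2). The induction therefore carries two consecutive exponents. *)
Lemma jexp_comm x n : forall y, x ∘ (jexp x n ∘ y) = jexp x n ∘ (x ∘ y).
Proof.
suff [] : (forall y, x ∘ (jexp x n ∘ y) = jexp x n ∘ (x ∘ y)) /\
  (forall y, x ∘ (jexp x n.+1 ∘ y) = jexp x n.+1 ∘ (x ∘ y)) by [].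
have sqE m : (x ∘ x) ∘ jexp x m = jexp x m.+2.
  by elim: m => [|m IH]; rewrite /= ?jmul1r // jmul_jordan IH.
elim: n => [|n [IH0 IH1]]; first by split=> y /=; rewrite ?jmul1 ?jmul1r ?jmul1.
split=> // y.
have jexp2E z : jexp x n.+2 ∘ z = 2 *: (x ∘ (jexp x n.+1 ∘ z)) +
    (x ∘ x) ∘ (jexp x n ∘ z) - 2 *: (x ∘ (x ∘ (jexp x n ∘ z))).
  have := jordan_lin1 x z (jexp x n); rewrite sqE.
  rewrite -[x ∘ jexp x n]/(jexp x n.+1) [z ∘ jexp _ _.+2]jmulC.
  rewrite [z ∘ jexp _ _]jmulC [_ ∘ jexp _ _.+1]jmulC [_ ∘ jexp _ n]jmulC.
  by rewrite -IH0 -IH1 => H; rowlra.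
by rewrite !jexp2E !jmulBr !jmulDr !jmulZr -!IH0 -!IH1 jmul_jordan.
Qed.

Lemma quad_repDr x y z : quad_rep J x (y + z) = quad_rep J x y + quad_rep J x z.
Proof. by rewrite !quad_repE jtripleDm. Qed.

Lemma quad_repZr a x y : quad_rep J x (a *: y) = a *: quad_rep J x y.
Proof. by rewrite !quad_repE jtripleZm. Qed.

Lemma quad_repBr x y z : quad_rep J x (y - z) = quad_rep J x y - quad_rep J x z.
Proof. by rewrite !quad_repE jtripleBm. Qed.

Lemma quad_rep_unit x : quad_rep J x e = x ∘ x.
Proof. by rewrite /quad_rep /jsqr !jmul1r; rowlra. Qed.

Lemma quad_unit_rep x : quad_rep J e x = x.
Proof. by rewrite /quad_rep /jsqr !jmul1; rowlra. Qed.

Lemma quad_rep_sqr x y : quad_rep J (x ∘ x) y = quad_rep J x (quad_rep J x y).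
Proof. by rewrite -quad_rep_unit quad_rep_fundamental quad_unit_rep. Qed.

(** Jordan invertibility phrased with P alone, so that the fundamental formula applies directly and
    makes P(h) and P(k) mutually inverse. *)
Definition inverse_pair h k := quad_rep J h k = h /\ quad_rep J h (k ∘ k) = e.

(* [P h P k P k P h] and [P h P k P h] are [P e] and [P h] by the fundamental
   formula. *)
Lemma inverse_pair_quad h k x : inverse_pair h k ->
  quad_rep J h (quad_rep J k x) = x /\ quad_rep J k (quad_rep J h x) = x.
Proof.
move=> [hk hkk].
have HKKH y : quad_rep J h (quad_rep J k (quad_rep J k (quad_rep J h y))) = y.
  by rewrite -quad_rep_sqr -quad_rep_fundamental hkk quad_unit_rep.
have HKH y : quad_rep J h (quad_rep J k (quad_rep J h y)) = quad_rep J h y.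
  by rewrite -quad_rep_fundamental hk.
have KH y : quad_rep J k (quad_rep J h y) = y.
  by rewrite -[LHS]HKKH HKH HKKH.
by split=> //; rewrite -{1}(HKKH x) HKH HKKH.
Qed.

Lemma inverse_pair_sym h k : inverse_pair h k -> inverse_pair k h.
Proof.
move=> hk; have HK x := (inverse_pair_quad x hk).1.
have KH x := (inverse_pair_quad x hk).2.
have kh : quad_rep J k h = k by rewrite -{1}hk.1 KH.
by split=> //; rewrite -quad_rep_unit KH.
Qed.

Lemma inverse_pair_quad_rep g g' z z' : inverse_pair g g' ->
  inverse_pair z z' ->
  inverse_pair (quad_rep J g z) (quad_rep J g' z').
Proof.
move=> gg' zz'; have GG x := (inverse_pair_quad x gg').1.
split; first by rewrite quad_rep_fundamental GG zz'.1.
rewrite -quad_rep_unit !quad_rep_fundamental GG (inverse_pair_quad _ zz').1.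
by rewrite GG.
Qed.

End JordanIdentities.

(** * Selfadjoint operators *)

(** Take a complex root a + ib. If b is nonzero, the remainder modulo (X - a)^2 + b^2 is a real
    polynomial of degree at most 1 vanishing at a non-real point, hence zero. *)
Lemma real_poly_factor (R : rcfType) (p : {poly R}) : (1 < size p)%N ->
  (exists a q, p = q * ('X - a%:P)) \/
  (exists a b q, b != 0 /\ p = q * (('X - a%:P) ^+ 2 + (b ^+ 2)%:P)).
Proof.
move=> p_gt1; pose toC := real_complex R.
have [|z] := closed_rootP (map_poly toC p) _.
  by rewrite size_map_poly; rewrite gtn_eqF.
case: z => a b rz.
have [b0|b0] := eqVneq b 0.
  left; exists a.
  have /factor_theorem [q ->] : root p a by rewrite -(fmorph_root toC);
    rewrite b0 in rz.
  by exists q.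
right; exists a, b.
set m := ('X - a%:P) ^+ 2 + (b ^+ 2)%:P.
have sz2 : size (('X - a%:P) ^+ 2) = 3 by rewrite size_exp_XsubC.
have szm : size m = 3.
  rewrite size_polyDl sz2 // size_polyC; by case: (_ == _).
have m0 : m != 0 by rewrite -size_poly_eq0 szm.
exists (p %/ m); split=> //.
suff pm0 : p %% m = 0 by rewrite {1}(divp_eq p m) pm0 addr0.
set r := p %% m.
have szr : (size r <= 2)%N by have := ltn_modpN0 p m0; rewrite szm.
have rE : r = (r`_1)%:P * 'X + (r`_0)%:P.
  apply/polyP => -[|[|i]];
    rewrite coefD coefMX !coefC ?coefC /= ?addr0 ?add0r //.
  by rewrite nth_default // (leq_trans szr).
have rz0 : root (map_poly toC r) (Complex a b).
  move: rz; rewrite {1}(divp_eq p m) rmorphD rmorphM /= !rootE hornerD hornerM.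
  suff -> : (map_poly toC m).[Complex a b] = 0 by rewrite mulr0 add0r.
  rewrite /m rmorphD rmorphXn rmorphB /= map_polyX !map_polyC /=.
  rewrite !hornerE /=; apply/eqP; rewrite eq_complex /=; apply/andP; split;
    apply/eqP; rewrite /=; ring.
move: rz0;
  rewrite rE rmorphD rmorphM /= map_polyX !map_polyC /= rootE !hornerE /=.
rewrite eq_complex /= => /andP[/eqP h1 /eqP h2].
have r1 : r`_1 = 0 by apply: (mulIf b0); rewrite mul0r -[RHS]h2; ring.
have r0 : r`_0 = 0 by rewrite -[RHS]h1 r1; ring.
by rewrite r1 r0 !polyC0 mul0r addr0.
Qed.

(** The condition in [euclidean] as a predicate on the form, so that the same lemmas serve the given
    form and, later, the trace form. *)
Definition associative_ip (R : realType) (d : nat) (J : jordanAlgebra R d)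
    (ip : 'rV[R]_d -> 'rV[R]_d -> R) : Prop :=
  [/\ forall y, scalar (fun x => ip x y),
      forall x y, ip x y = ip y x,
      forall x, x != 0 -> 0 < ip x x
    & forall x y z, ip (jmul J x y) z = ip y (jmul J x z)].

Section Spectral.
Variables (R : realType) (d : nat) (J : jordanAlgebra R d).
Variable ip : 'rV[R]_d -> 'rV[R]_d -> R.
Hypothesis ipP : associative_ip J ip.
Implicit Types x y z u v w : 'rV[R]_d.

Local Notation "x ∘ y" := (jmul J x y) (at level 40, left associativity).
Local Notation e := (junit J).

Lemma ipC x y : ip x y = ip y x. Proof. by case: ipP. Qed.

Lemma ipDl x y z : ip (x + y) z = ip x z + ip y z.
Proof. by case: ipP => + _ _ _ => /(_ z 1 x y) /=; rewrite scale1r mul1r. Qed.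

Lemma ipDr x y z : ip z (x + y) = ip z x + ip z y.
Proof. by rewrite ipC ipDl !(ipC z). Qed.

Lemma ip0l x : ip 0 x = 0.
Proof. by apply: (@addIr _ (ip 0 x)); rewrite -ipDl !add0r. Qed.

Lemma ip0r x : ip x 0 = 0.
Proof. by rewrite ipC ip0l. Qed.

Lemma ipZl a x z : ip (a *: x) z = a * ip x z.
Proof.
by case: ipP => + _ _ _ => /(_ z a x 0) /=; rewrite !addr0 ip0l addr0.
Qed.

Lemma ipZr a x z : ip z (a *: x) = a * ip z x.
Proof. by rewrite ipC ipZl ipC. Qed.

Lemma ipNl x z : ip (- x) z = - ip x z.
Proof. by rewrite -scaleN1r ipZl mulN1r. Qed.

Lemma ipNr x z : ip z (- x) = - ip z x.
Proof. by rewrite ipC ipNl ipC. Qed.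

Lemma ipBl x y z : ip (x - y) z = ip x z - ip y z.
Proof. by rewrite ipDl ipNl. Qed.

Lemma ipBr x y z : ip z (x - y) = ip z x - ip z y.
Proof. by rewrite ipDr ipNr. Qed.

Lemma ip_suml I (s : seq I) (P : pred I) (F : I -> 'rV[R]_d) z :
  ip (\sum_(i <- s | P i) F i) z = \sum_(i <- s | P i) ip (F i) z.
Proof.
  exact: (big_morph (fun x => ip x z) (fun x y => ipDl x y z) (ip0l z)). Qed.

Lemma ip_sumr I (s : seq I) (P : pred I) (F : I -> 'rV[R]_d) z :
  ip z (\sum_(i <- s | P i) F i) = \sum_(i <- s | P i) ip z (F i).
Proof. by rewrite ipC ip_suml; apply: eq_bigr => i _; rewrite ipC. Qed.

Lemma ip_gt0 x : x != 0 -> 0 < ip x x.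
Proof. by case: ipP => _ _ + _ => /[apply]. Qed.

Lemma ip_ge0 x : 0 <= ip x x.
Proof. by have [->|/ip_gt0/ltW//] := eqVneq x 0; rewrite ip0l. Qed.

Lemma ip_eq0 x : ip x x = 0 -> x = 0.
Proof. by apply: contra_eq => /ip_gt0; rewrite lt0r => /andP[]. Qed.

Lemma ip_ext x y : (forall z, ip x z = ip y z) -> x = y.
Proof.
by move=> xy; apply/subr0_eq/ip_eq0; rewrite ipBl xy subrr.
Qed.

Lemma ip_jmul x y z : ip (x ∘ y) z = ip y (x ∘ z).
Proof. by case: ipP. Qed.

Lemma ip_jmulr x y z : ip (x ∘ y) z = ip x (y ∘ z).
Proof. by rewrite jmulC ip_jmul. Qed.

Let ipE := (ipDl, ipDr, ipBl, ipBr, ipNl, ipNr, ipZl, ipZr).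

Lemma ip_quad_rep x y z : ip (quad_rep J x y) z = ip y (quad_rep J x z).
Proof. by rewrite /quad_rep !ipE !ip_jmul. Qed.

Section SelfAdjoint.
Variable T : 'rV[R]_d -> 'rV[R]_d.
Hypothesis TD : forall x y, T (x + y) = T x + T y.
Hypothesis TZ : forall a x, T (a *: x) = a *: T x.
Hypothesis T_adj : forall x y, ip (T x) y = ip x (T y).

Let TN x : T (- x) = - T x. Proof. by rewrite -scaleN1r TZ scaleN1r. Qed.

Let T0 : T 0 = 0. Proof.
  by rewrite -{1}(scale0r (0 : 'rV[R]_d)) TZ scale0r. Qed.

Let shift a v := T v - a *: v.

Lemma shift_adj a x y : ip (shift a x) y = ip x (shift a y).
Proof. by rewrite /shift !ipE T_adj. Qed.

Lemma shift_sqr a w : shift a (shift a w) = 0 -> shift a w = 0.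
Proof. by move=> SS; apply: ip_eq0; rewrite shift_adj SS ip0r. Qed.

(** Pairing the equation with w gives |S w|^2 + b^2 |w|^2 = 0, where S is [shift a]: a selfadjoint
    operator has no non-real eigenvalue. *)
Lemma shift_sqr_pos a b w : b != 0 ->
  shift a (shift a w) + b ^+ 2 *: w = 0 -> w = 0.
Proof.
move=> b0 /(congr1 (ip w)); rewrite ip0r ipDr ipZr -shift_adj => h.
apply: ip_eq0; apply/eqP; have := ip_ge0 (shift a w); have := ip_ge0 w.
have b2 : 0 < b ^+ 2 by rewrite lt_neqAle sqr_ge0 eq_sym sqrf_eq0 b0.
by rewrite eq_le => w0 s0; rewrite w0 andbT -(pmulr_rle0 _ b2); lra.
Qed.

(** The predicate [W] records that the eigencomponents stay in any T-stable subspace containing v;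
    it will be the span of the powers of one element. *)
Lemma eigen_sum_of_roots (W : 'rV[R]_d -> Prop)
    (WD : forall x y, W x -> W y -> W (x + y))
    (WZ : forall a x, W x -> W (a *: x)) (WT : forall x, W x -> W (T x)) s v :
  uniq s -> W v -> foldr shift v s = 0 ->
  exists c : R -> 'rV[R]_d, [/\ v = \sum_(a <- s) c a,
    forall a, a \in s -> W (c a) & forall a, a \in s -> T (c a) = a *: c a].
Proof.
elim/last_ind: s v => [|s a IH] v.
  by move=> _ _ /= ->; exists (fun=> 0); rewrite big_nil.
rewrite rcons_uniq foldr_rcons => /andP[a_s s_uniq] Wv.
have Wshift : W (shift a v).
  by apply/WD; [exact: WT | rewrite -scaleNr; exact: WZ].
case/(IH _ s_uniq Wshift) => c [vE Wc Tc].
(* On the b-eigenspace [shift a] is multiplication by b - a, so the subtracted sum has the same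
   image under [shift a] as v, and u is an a-eigenvector. *)
pose u := v - \sum_(b <- s) (b - a)^-1 *: c b.
have Tu : T u = a *: u.
  apply/eqP; rewrite -subr_eq0; apply/eqP.
  have TsE : T (\sum_(b <- s) (b - a)^-1 *: c b) =
      \sum_(b <- s) (b - a)^-1 *: T (c b).
    by rewrite (big_morph T TD T0); apply: eq_bigr => b _; rewrite TZ.
  rewrite /u TD TN TsE scalerBr opprB [_ - a *: v]addrC addrACA.
  rewrite -[T v - _]/(shift a v) vE.
  rewrite scaler_sumr -sumrN -!big_split /= big_seq big1 // => b bs.
  have ba : b - a != 0 by rewrite subr_eq0; apply: contraNneq a_s => <-.
  rewrite (Tc b bs) !scalerA -scaleNr -scalerDl -[X in X + _]scale1r -scalerDl.
  by rewrite (_ : _ + _ = 0) ?scale0r //; field.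
pose c' b := if b == a then u else (b - a)^-1 *: c b.
have c'E b : b \in s -> c' b = (b - a)^-1 *: c b.
  by rewrite /c'; case: eqP => // -> as'; rewrite as' in a_s.
have sumE : \sum_(b <- s) c' b = \sum_(b <- s) (b - a)^-1 *: c b.
  by rewrite big_seq [RHS]big_seq; apply: eq_bigr => b /c'E.
have Wc' b : b \in s -> W (c' b) by move=> bs; rewrite c'E //; apply/WZ/Wc.
exists c'; split=> [|b|b].
- by rewrite -cats1 big_cat big_seq1 /= sumE /c' eqxx addrC subrK.
- rewrite mem_rcons inE => /predU1P[->|]; last exact: Wc'.
  rewrite /c' eqxx; apply/WD => //; rewrite -scaleN1r; apply/WZ.
  rewrite -sumE big_seq; apply: (big_ind W) => [|x y|b']; last exact: Wc'.
    by rewrite -(scale0r v); apply/WZ.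
  exact: WD.
- rewrite mem_rcons inE => /predU1P[->|bs]; first by rewrite /c' eqxx.
  by rewrite c'E // TZ Tc // !scalerA mulrC.
Qed.

End SelfAdjoint.

End Spectral.

(* Reducing an annihilating polynomial of [v]: an irreducible quadratic factor
   or a repeated root can be dropped because [A] is selfadjoint. *)
Lemma selfadjoint_roots (R : realType) (d : nat) (J : jordanAlgebra R d.+1)
    (ip : 'rV[R]_d.+1 -> 'rV[R]_d.+1 -> R) (ipP : associative_ip J ip)
    (A : 'M[R]_d.+1) (v : 'rV[R]_d.+1) :
  (forall x y, ip (x *m A) y = ip x (y *m A)) ->
  exists s : seq R, uniq s /\
    v *m horner_mx A (\prod_(a <- s) ('X - a%:P)) = 0.
Proof.
move=> A_adj.
have TD x y : (x + y) *m A = x *m A + y *m A by rewrite mulmxDl.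
have TZ a x : (a *: x) *m A = a *: (x *m A) by rewrite scalemxAl.
pose shift a (w : 'rV[R]_d.+1) := w *m A - a *: w.
have shiftE a q : v *m horner_mx A (q * ('X - a%:P)) =
    shift a (v *m horner_mx A q).
  rewrite rmorphM rmorphB /= horner_mx_X horner_mx_C -mulmxE mulmxA mulmxBr.
  by rewrite mul_mx_scalar.
(* Here p is the factor still to be reduced and s lists the distinct real roots already split off.
   Cayley-Hamilton starts the induction with s empty. *)
suff gen n : forall (p : {poly R}) s, (size p <= n)%N -> p != 0 -> uniq s ->
    v *m horner_mx A (p * \prod_(a <- s) ('X - a%:P)) = 0 ->
    exists s : seq R, uniq s /\
      v *m horner_mx A (\prod_(a <- s) ('X - a%:P)) = 0.
  apply: (gen _ (char_poly A) [::] (leqnn _)) => //.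
    exact/monic_neq0/char_poly_monic.
  by rewrite big_nil mulr1 Cayley_Hamilton mulmx0.
elim: n => [|n IH] p s.
  by rewrite leqn0 size_poly_eq0 => ->.
move=> sz p0 s_uniq; have [sz1|sz1] := leqP (size p) 1.
  have [c /eqP c0 ->] : exists2 c, c <> 0 & p = c%:P.
    have /size_poly1P[c c0 ->] : size p == 1%N.
      by rewrite eqn_leq sz1 lt0n size_poly_eq0.
    by exists c => //; apply/eqP.
  rewrite mul_polyC linearZ /= -scalemxAr => /eqP.
  by rewrite scaler_eq0 (negPf c0) /= => /eqP; exists s.
have [[a [q pE]]|[a [b [q [b0 pE]]]]] := real_poly_factor sz1.
- have q0 : q != 0 by apply: contraNneq p0 => q0; rewrite pE q0 mul0r.
  have szq : (size q <= n)%N.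
    by move: sz; rewrite pE size_Mmonic ?monicXsubC // size_XsubC addn2.
  have [a_s|a_s] := boolP (a \in s).
    rewrite pE mulrAC shiftE (perm_big _ (perm_to_rem a_s)) big_cons /=.
    rewrite [q * _]mulrCA mulrC shiftE => h.
    apply: (IH q s) => //.
    rewrite (perm_big _ (perm_to_rem a_s)) big_cons mulrCA mulrC shiftE.
    exact: (shift_sqr ipP A_adj).
  rewrite pE -mulrA => h; apply: (IH q (a :: s)) => //; first by rewrite /= a_s.
  by rewrite big_cons.
- have q0 : q != 0 by apply: contraNneq p0 => q0; rewrite pE q0 mul0r.
  have szm : size (('X - a%:P) ^+ 2 + (b ^+ 2)%:P) = 3.
    by rewrite size_polyDl size_exp_XsubC // size_polyC; case: (_ == _).
  have szq : (size q <= n)%N.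
    move: sz; rewrite pE size_mul // ?szm -?size_poly_eq0 ?szm // addn3 /=.
    exact: ltnW.
  rewrite pE mulrAC mulrDr expr2 mulrA rmorphD /= mulmxDr !shiftE.
  rewrite [_ * (b ^+ 2)%:P]mulrC mul_polyC linearZ /= -scalemxAr => h.
  by apply: (IH q s) => //; exact: (shift_sqr_pos ipP A_adj b0 h).
Qed.

(** * Spectral decomposition *)

(** The span of the powers of x, given by its closure rules so that operator commutation with x
    follows by induction. *)
Inductive jpoly (R : realType) (d : nat) (J : jordanAlgebra R d) (x : 'rV[R]_d)
  :
    'rV[R]_d -> Prop :=
  | Jexp n : jpoly J x (jexp J x n)
  | Jadd y z : jpoly J x y -> jpoly J x z -> jpoly J x (y + z)
  | Jscale a y : jpoly J x y -> jpoly J x (a *: y).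

Lemma jpoly_mul (R : realType) d (J : jordanAlgebra R d) x y :
  jpoly J x y -> jpoly J x (jmul J x y).
Proof.
elim=> [n|u v _ IHu _ IHv|a u _ IH]; first exact: (Jexp J x n.+1).
- by rewrite jmulDr; apply: Jadd.
- by rewrite jmulZr; apply: Jscale.
Qed.

Lemma jpoly_comm (R : realType) d (J : jordanAlgebra R d) x y : jpoly J x y ->
  forall z, jmul J x (jmul J y z) = jmul J y (jmul J x z).
Proof.
elim=> [n z|u v _ IHu _ IHv z|a u _ IH z]; first exact: jexp_comm.
- by rewrite !jmulDl jmulDr IHu IHv.
- by rewrite !jmulZl jmulZr IH.
Qed.

(** Decomposing the unit, rather than x, into eigenvectors of L(x) produces the spectral idempotents
    of x. *)
Lemma unit_eigen_sum (R : realType) d (J : jordanAlgebra R d) ip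
    (ipP : associative_ip J ip) (x : 'rV[R]_d) :
  exists (s : seq R) (c : R -> 'rV[R]_d), [/\ uniq s,
    junit J = \sum_(a <- s) c a,
    forall a, a \in s -> jmul J x (c a) = a *: c a
    & forall a, a \in s -> jpoly J x (c a)].
Proof.
case: d J ip ipP x => [|d] J ip ipP x.
  by exists [::], (fun=> 0); split; rewrite ?big_nil //; apply/rowP => -[].
pose A := \matrix_(i < d.+1) jmul J x (delta_mx 0 i).
have AE v : v *m A = jmul J x v.
  rewrite mulmx_sum_row [in RHS](row_sum_delta v) jmul_sumr.
  by apply: eq_bigr => i _; rewrite jmulZr rowK.
have A_adj u v : ip (u *m A) v = ip u (v *m A) by rewrite !AE (ip_jmul ipP).
have [s [s_uniq sE]] := selfadjoint_roots ipP (junit J) A_adj.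
have TD u v := jmulDr J u v x.
have TZ a u := jmulZr J a u x.
have T_adj u v : ip (jmul J x u) v = ip u (jmul J x v) by rewrite (ip_jmul ipP).
have foldE : foldr (fun a v => jmul J x v - a *: v) (junit J) s = 0.
  rewrite -sE; elim: {s_uniq sE} s => [|a s IH]; rewrite /= ?big_nil ?big_cons.
    by rewrite rmorph1 mulmx1.
  rewrite IH mulrC rmorphM rmorphB /= horner_mx_X horner_mx_C.
  by rewrite -mulmxE mulmxA mulmxBr mul_mx_scalar AE.
have [|c [eE Wc cE]] := eigen_sum_of_roots TD TZ (@Jadd _ _ J x) (@Jscale _ _ J
  x)
  (@jpoly_mul _ _ J x) s_uniq (Jexp J x 0) _; first exact: foldE.
by exists s, c; split.
Qed.

(** * Idempotents and their refinement to Jordan frames *)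

Section Peirce.
Variables (R : realType) (d : nat) (J : jordanAlgebra R d).
Variable ip : 'rV[R]_d -> 'rV[R]_d -> R.
Hypothesis ipP : associative_ip J ip.
Implicit Types x y z u v w : 'rV[R]_d.

Local Notation "x ∘ y" := (jmul J x y) (at level 40, left associativity).
Local Notation e := (junit J).

Lemma spectral_idempotents x : exists (s : seq R) (c : R -> 'rV[R]_d),
  [/\ uniq s, e = \sum_(a <- s) c a, x = \sum_(a <- s) a *: c a,
      forall a, a \in s -> c a ∘ c a = c a
    & {in s &, forall a b, a != b -> c a ∘ c b = 0}].
Proof.
have [s [c [s_uniq eE cE Wc]]] := unit_eigen_sum ipP x.
(* L(x) commutes with L(c_a) and L(c_b), so x ∘ (c_a ∘ c_b) equals both b and a times c_a ∘ c_b. *)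
have c_orth : {in s &, forall a b, a != b -> c a ∘ c b = 0}.
  move=> a b a_s b_s ab; have := jpoly_comm (Wc a a_s) (c b).
  rewrite cE // jmulZr jmulC => h1; have := jpoly_comm (Wc b b_s) (c a).
  rewrite cE // jmulZr jmulC [c b ∘ _]jmulC h1 => /eqP.
  by rewrite -subr_eq0 -scalerBl scaler_eq0 subr_eq0 eq_sym (negPf ab) => /eqP.
exists s, c; split=> //.
  rewrite -[LHS](jmul1r J) eE jmul_sumr big_seq [RHS]big_seq.
  by apply: eq_bigr => a /cE.
move=> a a_s;
  rewrite -[RHS](jmul1r J) eE jmul_sumr (bigD1_seq a) //= big_seq_cond.
by rewrite big1 ?addr0 // => b /andP[bs ba]; rewrite c_orth // eq_sym.
Qed.

(** Modulo 2L^3 = 3L^2 - L one has L = L^2 + 4(L - L^2)^2. This sum of squares shows that L(c) is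
    positive semidefinite and identifies the null vectors of its form with its kernel. *)
Lemma idem_ip_jmul c x : c ∘ c = c ->
  ip (c ∘ x) x = ip (c ∘ x) (c ∘ x) +
    4 * ip (c ∘ x - c ∘ (c ∘ x)) (c ∘ x - c ∘ (c ∘ x)).
Proof.
move=> cc; have h := idem_quad x cc.
have := congr1 (ip x) h; have := congr1 (ip (c ∘ x)) h.
rewrite !(ipDl ipP, ipDr ipP, ipNl ipP, ipNr ipP, ipZr ipP, ip_jmul ipP,
  jmulDr, jmulNr, jmulZr).
set m1 := ip x (c ∘ x); set m2 := ip x (c ∘ (c ∘ x)).
set m3 := ip x (c ∘ (c ∘ (c ∘ x))); set m4 := ip x (c ∘ (c ∘ (c ∘ (c ∘ x)))).
lra.
Qed.

Lemma idem_psd c x : c ∘ c = c -> 0 <= ip (c ∘ x) x.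
Proof.
by move=> cc; rewrite idem_ip_jmul // addr_ge0 ?mulr_ge0 // (ip_ge0 ipP).
Qed.

Lemma idem_kernel c x : c ∘ c = c -> ip (c ∘ x) x = 0 -> c ∘ x = 0.
Proof.
move=> cc; rewrite idem_ip_jmul // => h; apply: (ip_eq0 ipP).
have := ip_ge0 ipP (c ∘ x); have := ip_ge0 ipP (c ∘ x - c ∘ (c ∘ x)).
by move=> *; apply/eqP; rewrite eq_le; apply/andP; split; lra.
Qed.

Lemma idem_ipE a b : b ∘ b = b -> ip a b = ip (a ∘ b) b.
Proof. by move=> bb; rewrite (ip_jmulr ipP) bb. Qed.

Lemma idem_ip_ge0 a b : a ∘ a = a -> b ∘ b = b -> 0 <= ip a b.
Proof. by move=> aa bb; rewrite idem_ipE // idem_psd. Qed.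

Lemma idem_ip_eq0 a b : a ∘ a = a -> b ∘ b = b -> ip a b = 0 -> a ∘ b = 0.
Proof. by move=> aa bb; rewrite idem_ipE //; exact: idem_kernel. Qed.

Lemma orth_ip a b : a ∘ a = a -> a ∘ b = 0 -> ip a b = 0.
Proof. by move=> aa ab; rewrite -aa (ip_jmul ipP) ab (ip0r ipP). Qed.

Lemma idem_sum_orth a b : a ∘ a = a -> b ∘ b = b -> (a + b) ∘ (a + b) = a + b ->
  a ∘ b = 0.
Proof.
move=> aa bb; rewrite !(jmulDl, jmulDr) aa bb (jmulC J b a) => h.
have : 2 *: (a ∘ b) = 0 by rowlra.
by move/eqP; rewrite scaler_eq0 pnatr_eq0 => /eqP.
Qed.

(** A Jordan frame with primitivity weakened to being nonzero, so that it can be refined step by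
    step. *)
Definition orth_system (r : nat) (c : 'I_r -> 'rV[R]_d) :=
  [/\ forall i, c i ∘ c i = c i, forall i, c i != 0,
      forall i j, i != j -> c i ∘ c j = 0 & \sum_i c i = e].

Lemma orth_system_size r (c : 'I_r -> 'rV[R]_d) : orth_system c -> (r <= d)%N.
Proof.
case=> cc c0 c_orth _; pose M := \matrix_i c i.
suff /eqP <- : row_free M by apply: rank_leq_col.
apply: inj_row_free => v; rewrite mulmx_sum_row => vM.
apply/rowP => j; rewrite mxE; have := congr1 (ip ^~ (c j)) vM.
rewrite (ip0l ipP) (ip_suml ipP) (bigD1 j) //= big1 ?addr0.
  rewrite rowK (ipZl ipP) => /eqP; rewrite mulf_eq0 => /orP[/eqP //|/eqP].
  by move/(ip_eq0 ipP)/eqP; rewrite (negPf (c0 j)).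
by move=> i ij; rewrite rowK (ipZl ipP) orth_ip ?mulr0 // c_orth.
Qed.

Lemma spectral_orth_system x : exists r (c : 'I_r -> 'rV[R]_d) (l : 'I_r -> R),
  orth_system c /\ x = \sum_i l i *: c i.
Proof.
have [s [c [s_uniq eE xE cc c_orth]]] := spectral_idempotents x.
pose t := [seq a <- s | c a != 0]; pose f i := tnth (in_tuple t) i.
have f_in i : f i \in s /\ c (f i) != 0.
  by have := mem_tnth i (in_tuple t); rewrite mem_filter => /andP[-> ->].
have sumE (F : R -> R) : \sum_(a <- s) F a *: c a = \sum_i F (f i) *: c (f i).
  rewrite -(big_tnth _ _ _ xpredT (fun a => F a *: c a)) big_filter.
  rewrite [RHS]big_mkcond; apply: eq_bigr => a _.
  by case: eqP => //= ->; rewrite scaler0.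
exists (size t), (fun i => c (f i)), f; split; last by rewrite xE (sumE id).
split=> [i|i|i j ij|]; [by apply: cc; case: (f_in i) | by case: (f_in i) | | ].
  apply: c_orth; [by case: (f_in i) | by case: (f_in j) |].
  have /tuple_uniqP f_inj : uniq (in_tuple t) by apply: filter_uniq.
  by apply: contraNneq ij => /f_inj ->.
rewrite eE; have := sumE (fun=> 1).
by under eq_bigr do rewrite scale1r; under [RHS]eq_bigr do rewrite scale1r.
Qed.

Lemma orth_system_split r (c : 'I_r -> 'rV[R]_d) (l : 'I_r -> R) i u v :
  orth_system c -> u ∘ u = u -> v ∘ v = v -> u != 0 -> v != 0 -> c i = u + v ->
  exists (c' : 'I_r.+1 -> 'rV[R]_d) (l' : 'I_r.+1 -> R),
    orth_system c' /\ \sum_j l j *: c j = \sum_j l' j *: c' j.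
Proof.
move=> [cc c0 c_orth cE] uu vv u0 v0 ciE.
have uv : u ∘ v = 0 by apply: idem_sum_orth => //; rewrite -ciE.
(* Both products are nonnegative and they add up to (c_i, c_j) = 0. *)
have ip_uv j : j != i -> ip u (c j) = 0 /\ ip v (c j) = 0.
  move=> ji; have : ip (c i) (c j) = 0 by apply: orth_ip => //;
    rewrite c_orth // eq_sym.
  rewrite ciE (ipDl ipP) => h; have hu := idem_ip_ge0 uu (cc j).
  have hv := idem_ip_ge0 vv (cc j).
  by split; apply/eqP; rewrite eq_le; apply/andP; split; lra.
have uc j : j != i -> u ∘ c j = 0.
  by move=> /ip_uv[h _]; exact: idem_ip_eq0.
have vc j : j != i -> v ∘ c j = 0.
  by move=> /ip_uv[_ h]; exact: idem_ip_eq0.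
pose cu j := if j == i then u else c j.
have sumE (k : 'I_r -> R) : \sum_j k j *: c j = \sum_j k j *: cu j + k i *: v.
  have cui : cu i = u by rewrite /cu eqxx.
  rewrite (bigD1 i) //= [in RHS](bigD1 i) //= cui ciE scalerDr [RHS]addrAC.
  congr (_ + _ + _); apply: eq_bigr => j ji; by rewrite /cu (negPf ji).
(* [u] takes the place of c_i, while [v] goes to the new last index and inherits the eigenvalue
   l_i. *)
exists (fun j => if unlift ord_max j is Some j' then cu j' else v).
exists (fun j => if unlift ord_max j is Some j' then l j' else l i).
have big_unlift (F : 'I_r -> 'rV[R]_d) (G : 'rV[R]_d) :
    \sum_(j < r.+1) (if unlift ord_max j is Some j' then F j' else G) =
    \sum_j F j + G.
  rewrite big_ord_recr /= unlift_none; congr (_ + _); apply: eq_bigr => j _.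
  rewrite (_ : widen_ord _ j = lift ord_max j) ?liftK //.
  by apply: val_inj; rewrite /= /bump leqNgt ltn_ord.
have cucu j : cu j ∘ cu j = cu j by rewrite /cu; case: eqP.
have vcu j : v ∘ cu j = 0.
  by rewrite /cu; have [_|/vc//] := eqVneq j i; rewrite jmulC.
split; first split.
- by move=> j; case: unliftP.
- by move=> j; case: unliftP => // j' _; rewrite /cu; case: (j' == i).
- move=> j k; case: (unliftP ord_max j) => [j'|] ->;
    case: (unliftP ord_max k) => [k'|] -> jk.
  + have {}jk : j' != k' by apply: contraNneq jk => ->.
    rewrite /cu; have [ji|ji] := eqVneq j' i; have [ki|ki] := eqVneq k' i.
    * by rewrite ji ki eqxx in jk.
    * exact: uc.
    * by rewrite jmulC; apply: uc.
    * exact: c_orth.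
  + by rewrite jmulC vcu.
  + exact: vcu.
  + by rewrite eqxx in jk.
- rewrite big_unlift -cE; have := sumE (fun=> 1).
  by under eq_bigr do rewrite scale1r; under [in RHS]eq_bigr do rewrite scale1r;
    rewrite scale1r.
- rewrite sumE -(big_unlift (fun j => l j *: cu j)); apply: eq_bigr => j _.
  by case: unliftP.
Qed.

(** Sizes of orthogonal systems are bounded by d, so one of maximal size diagonalizing x exists. A
    non-primitive member could be split, contradicting maximality. *)
Theorem spectral_exists x : exists r (c : 'I_r -> 'rV[R]_d) (l : 'I_r -> R),
  spectral_decomposition J x c l.
Proof.
pose P r := exists (c : 'I_r -> 'rV[R]_d) (l : 'I_r -> R),
  orth_system c /\ x = \sum_i l i *: c i.
have exP : exists r, `[< P r >].
  by have [r [c [l h]]] := spectral_orth_system x; exists r; apply/asboolP;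
    exists c, l.
have ubP r : `[< P r >] -> (r <= d)%N.
  by move=> /asboolP[c [l [+ _]]]; exact: orth_system_size.
have [r /asboolP[c [l [c_sys xE]]] r_max] := ex_maxnP exP ubP.
have [cc c0 c_orth cE] := c_sys.
exists r, c, l; split=> //; split=> // i.
split; [exact: cc | exact: c0 | case=> u [v [uu vv u0 v0 ciE]]].
have [c' [l' [c'_sys lE]]] := orth_system_split l c_sys uu vv u0 v0 ciE.
have : (r < r)%N by apply: r_max; apply/asboolP; exists c', l'; split;
  rewrite // xE.
by rewrite ltnn.
Qed.

End Peirce.

(** * The cone of squares *)

Section Cone.
Variables (R : realType) (d : nat) (J : jordanAlgebra R d).
Variable ip : 'rV[R]_d -> 'rV[R]_d -> R.
Hypothesis ipP : associative_ip J ip.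
Implicit Types x y z u v w : 'rV[R]_d.

Local Notation "x ∘ y" := (jmul J x y) (at level 40, left associativity).
Local Notation e := (junit J).
Local Notation K := (jcone J).

Let ipE := (ipDl ipP, ipDr ipP, ipBl ipP, ipBr ipP, ipNl ipP, ipNr ipP,
  ipZl ipP, ipZr ipP).

Lemma primitive_idem c : primitive_idempotent J c -> c ∘ c = c.
Proof. by case. Qed.

Lemma primitive_ip_gt0 c : primitive_idempotent J c -> 0 < ip c c.
Proof. by case=> _ c0 _; apply: (ip_gt0 ipP). Qed.

Lemma frame_jmul r (c : 'I_r -> 'rV[R]_d) (l m : 'I_r -> R) : jordan_frame J c
  ->
  (\sum_i l i *: c i) ∘ (\sum_i m i *: c i) = \sum_i (l i * m i) *: c i.
Proof.
move=> [c_prim c_orth _]; rewrite jmul_suml; apply: eq_bigr => i _.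
rewrite jmul_sumr (bigD1 i) //= big1 ?addr0 => [|j ji].
  by rewrite jmulZl jmulZr scalerA primitive_idem.
by rewrite jmulZl jmulZr c_orth ?scaler0 // eq_sym.
Qed.

Lemma frame_ip r (c : 'I_r -> 'rV[R]_d) (l : 'I_r -> R) i : jordan_frame J c ->
  ip (\sum_i l i *: c i) (c i) = l i * ip (c i) (c i).
Proof.
move=> [c_prim c_orth _];
  rewrite (ip_suml ipP) (bigD1 i) //= big1 ?addr0 => [|j ji].
  by rewrite (ipZl ipP).
by rewrite (ipZl ipP) (orth_ip ipP) ?mulr0 ?primitive_idem ?c_orth.
Qed.

Lemma cone_sqr x : K (x ∘ x). Proof. by exists x. Qed.

Lemma cone_idem c : c ∘ c = c -> K c. Proof. by move=> <-; apply: cone_sqr. Qed.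

Lemma cone_unit : K e. Proof. by apply: cone_idem; rewrite jmul1. Qed.

Lemma cone_ip_ge0 x y : K x -> K y -> 0 <= ip x y.
Proof.
move=> [v _ <-] [w _ <-];
  have [r [c [l [c_frame ->]]]] := spectral_exists ipP w.
rewrite /jsqr frame_jmul // (ip_sumr ipP) sumr_ge0 // => i _.
rewrite (ipZr ipP) mulr_ge0 -?expr2 ?sqr_ge0 // (ip_jmul ipP) (ipC ipP) jmulC.
by apply: (idem_psd ipP); apply: primitive_idem; case: c_frame.
Qed.

Lemma cone_spectralP x r (c : 'I_r -> 'rV[R]_d) (l : 'I_r -> R) :
  spectral_decomposition J x c l -> K x <-> forall i, 0 <= l i.
Proof.
move=> [c_frame ->]; have [c_prim _ _] := c_frame; split=> [Kx i|l_ge0].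
  rewrite -(pmulr_lge0 _ (primitive_ip_gt0 (c_prim i))) -frame_ip //.
  exact/cone_ip_ge0/cone_idem/primitive_idem.
exists (\sum_i Num.sqrt (l i) *: c i) => //; rewrite /jsqr frame_jmul //.
by apply: eq_bigr => i _; rewrite -expr2 sqr_sqrtr.
Qed.

(** Self-duality: testing against the members of a diagonalizing frame recovers the signs of the
    eigenvalues. Convexity of the cone is read off from it. *)
Lemma coneP x : K x <-> forall y, K y -> 0 <= ip x y.
Proof.
split=> [Kx y Ky|h]; first exact: cone_ip_ge0.
have [r [c [l xcl]]] := spectral_exists ipP x.
apply/(cone_spectralP xcl) => i; have [c_frame xE] := xcl.
have [c_prim _ _] := c_frame.
rewrite -(pmulr_lge0 _ (primitive_ip_gt0 (c_prim i))) -frame_ip // -xE.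
exact/h/cone_idem/primitive_idem.
Qed.

Lemma coneD x y : K x -> K y -> K (x + y).
Proof.
move=> Kx Ky; apply/coneP => z Kz.
by rewrite (ipDl ipP) addr_ge0 // cone_ip_ge0.
Qed.

Lemma coneZ a x : 0 <= a -> K x -> K (a *: x).
Proof.
move=> a0 Kx; apply/coneP => z Kz.
by rewrite (ipZl ipP) mulr_ge0 // cone_ip_ge0.
Qed.

Lemma cone0 : K 0. Proof. by rewrite -(scale0r e); apply: coneZ => //;
  exact: cone_unit. Qed.

Lemma cone_sum I (s : seq I) (P : pred I) (F : I -> 'rV[R]_d) :
  (forall i, P i -> K (F i)) -> K (\sum_(i <- s | P i) F i).
Proof. by move=> KF; apply: (big_ind K) => //;
  [exact: cone0 | exact: coneD]. Qed.

Lemma cone_order_unit v : exists2 C : R, 0 < C & K (C *: e + v) /\ K (C *: e -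
  v).
Proof.
have [r [c [l [c_frame ->]]]] := spectral_exists ipP v.
have [c_prim _ <-] := c_frame; pose C := 1 + \sum_i `|l i|.
have leC i : `|l i| <= C.
  rewrite /C (bigD1 i) //= addrCA lerDl addr_ge0 // sumr_ge0 //.
exists C; first by rewrite ltr_pwDl // sumr_ge0.
rewrite scaler_sumr -big_split -sumrB; split; apply: cone_sum => i _ /=.
  rewrite -scalerDl; apply: coneZ; last exact/cone_idem/primitive_idem.
  by have := leC i; rewrite ler_norml => /andP[]; lra.
rewrite -scalerBl; apply: coneZ; last exact/cone_idem/primitive_idem.
by have := leC i; rewrite ler_norml => /andP[]; lra.
Qed.

(** The interior in order-theoretic terms, relative to the order unit e; [cone_posP] is the link
    with the topology. *)
Definition cone_pos x := exists2 eps : R, 0 < eps & K (x - eps *: e).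

Lemma cone_pos_cone x : cone_pos x -> K x.
Proof.
case=> eps e0 Kx; rewrite -(subrK (eps *: e) x); apply: coneD => //.
by apply: coneZ; [exact: ltW | exact: cone_unit].
Qed.

Lemma cone_posD x y : cone_pos x -> K y -> cone_pos (x + y).
Proof. by case=> eps e0 Kx Ky; exists eps => //; rewrite addrAC;
  apply: coneD. Qed.

Lemma cone_posZ a x : 0 < a -> cone_pos x -> cone_pos (a *: x).
Proof.
move=> a0 [eps e0 Kx]; exists (a * eps); first exact: mulr_gt0.
by rewrite -scalerA -scalerBr; apply: coneZ => //; exact: ltW.
Qed.

Lemma cone_pos_order_unit x v : cone_pos x ->
  exists2 C : R, 0 < C & K (C *: x + v) /\ K (C *: x - v).
Proof.
move=> [eps e0 Kx]; have [C C0 [Kp Km]] := cone_order_unit v.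
have Ce0 : 0 < C / eps by rewrite divr_gt0.
exists (C / eps) => //.
have CE : (C / eps) *: x = (C / eps) *: (x - eps *: e) + C *: e.
  by rewrite scalerBr scalerA divfK ?gt_eqF // subrK.
rewrite CE -!addrA; split; apply: coneD => //; apply: coneZ => //; exact: ltW.
Qed.

Lemma cone_posP x : interior K x <-> cone_pos x.
Proof.
split=> [|[eps e0 Kx]].
  move=> /nbhs_ballP[eps /= e0 eK].
  (* [C] is positive and exceeds the norm of e, so subtracting (eps / C / 2) e from x stays inside
     the ball. *)
  pose C := 1 + `|e|; have C0 : 0 < C by rewrite ltr_pwDl.
  have eC0 : 0 < eps / C / 2 by rewrite !divr_gt0.
  exists (eps / C / 2) => //; apply: eK;
    rewrite -ball_normE /= opprB addrC subrK.
  have n0 := normr_ge0 e; rewrite normrZ gtr0_norm // -!mulrA.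
  by rewrite gtr_pMr // ltr_pdivrMl // /C; lra.
have [C CP] : exists C : 'I_d -> R, forall i, 0 < C i /\
    (K (C i *: e + delta_mx 0 i) /\ K (C i *: e - delta_mx 0 i)).
  have h i : exists C, 0 < C /\ (K (C *: e + delta_mx 0 i) /\ K (C *: e -
    delta_mx 0 i)).
    by have [C ? ?] := cone_order_unit (delta_mx 0 i); exists C.
  by have [C CP] := choice h; exists C.
(* Splitting eps e into (eps / D) e and the shares (eps / D) C_i e lets the i-th share absorb the
   i-th coordinate of y - x, which is at most eps / D in absolute value. *)
pose D := 1 + \sum_i C i.
have D0 : 0 < D by rewrite ltr_pwDl // sumr_ge0 // => i _; have [/ltW] := CP i.
apply/nbhs_ballP; exists (eps / D) => /=; first by rewrite divr_gt0.
move=> y; rewrite -ball_normE /= distrC => xy.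
rewrite (_ : y = (x - eps *: e) + (eps *: e + (y - x))); last first.
  by rewrite addrA subrK addrC subrK.
apply: coneD => //; rewrite (row_sum_delta (y - x)).
have -> : eps *: e = (eps / D) *: e + \sum_i ((eps / D) * C i) *: e.
  rewrite -scaler_suml -mulr_sumr -scalerDl -[X in X + _]mulr1 -mulrDr -/D.
  by rewrite divfK ?gt_eqF.
rewrite -addrA -big_split /=; apply: coneD.
  by apply: coneZ; [rewrite divr_ge0 // ltW | exact: cone_unit].
apply: cone_sum => i _.
have yi : `|(y - x) 0 i| <= eps / D.
  apply: le_trans (ltW xy).
  by rewrite /Num.norm /= mx_normrE;
    apply: (le_bigmax _ (fun ij => `|(y - x) ij.1 ij.2|) (0, i)).
have [_ [Kp Km]] := CP i.
set t := (y - x) 0 i in yi *; set s := eps / D in yi *.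
move: yi; rewrite ler_norml => /andP[t1 t2].
have splitE (a b h : R) u v : (a * h) *: u + b *: v =
    ((a + b) / 2) *: (h *: u + v) + ((a - b) / 2) *: (h *: u - v).
  by apply/rowP => k; rewrite !mxE; field.
by rewrite splitE; apply: coneD; apply: coneZ => //; lra.
Qed.

(** For x = sum l_i a_i one has 0 = (e - c, x^2) = sum l_i^2 (e - c, a_i) with nonnegative terms.
    Thus c ∘ a_i = a_i whenever l_i is nonzero, and primitivity of c forces a_i = c. *)
Lemma peirce1_primitive c x : primitive_idempotent J c -> c ∘ x = x ->
  exists k : R, x = k *: c.
Proof.
move=> [cc c0 c_prim] cx; rewrite /jidempotent /jsqr in cc.
have [r [a [l [a_frame xE]]]] := spectral_exists ipP x.
have [a_prim a_orth aE] := a_frame; have aa i := primitive_idem (a_prim i).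
pose c' := e - c.
have c'c' : c' ∘ c' = c'.
  by rewrite /c' !(jmulBl, jmulBr) jmul1 jmul1r cc subrr subr0 jmul1.
have c'x : c' ∘ x = 0 by rewrite /c' jmulBl jmul1 cx subrr.
have ac' i : l i != 0 -> c ∘ a i = a i.
  move=> li0; have : ip (c' ∘ x) x = 0 by rewrite c'x (ip0l ipP).
  rewrite (ip_jmulr ipP) {1 2}xE frame_jmul // (ip_sumr ipP).
  under eq_bigr do rewrite (ipZr ipP).
  move/eqP; rewrite psumr_eq0; last first.
    by move=> j _; rewrite mulr_ge0 -?expr2 ?sqr_ge0 // (idem_ip_ge0 ipP).
  move=> /allP /(_ i); rewrite mem_index_enum => /(_ isT) /=.
  rewrite !mulf_eq0 (negPf li0) /= => /eqP /(idem_ip_eq0 ipP c'c' (aa i)).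
  by rewrite /c' jmulBl jmul1 => /subr0_eq.
have [l0|[i li0]] : (forall i, l i = 0) \/ (exists i, l i != 0).
  have [/forallP h|] := boolP [forall i, l i == 0]; first by left=> i;
    apply/eqP.
  by rewrite negb_forall => /existsP; right.
  exists 0; rewrite xE big1 ?scale0r // => i _; by rewrite l0 scale0r.
have ca : c = a i.
  apply/eqP; rewrite -subr_eq0; apply/negP => /negP ca0; apply: c_prim.
  exists (a i), (c - a i); split; rewrite /jidempotent /jsqr //.
  - by rewrite !(jmulBl, jmulBr) cc (jmulC J (a i)) ac' // aa subrr subr0.
  - by case: (a_prim i).
  - by rewrite addrC subrK.
exists (l i); rewrite -cx xE ca jmul_sumr (bigD1 i) //= big1 ?addr0 => [|j ji].
  by rewrite jmulZr aa.
by rewrite jmulZr a_orth ?scaler0 // eq_sym.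
Qed.

(** The cubic equation of L(c) puts P(c)x in the Peirce 1-space, a line; pairing with c gives the
    coefficient. *)
Lemma quad_rep_primitive c x : primitive_idempotent J c ->
  quad_rep J c x = (ip x c / ip c c) *: c.
Proof.
move=> c_prim; have cc := primitive_idem c_prim.
have cP : c ∘ quad_rep J c x = quad_rep J c x.
  have h := idem_quad x cc; rewrite /quad_rep /jsqr cc jmulBr jmulZr h.
  by rowlra.
have [k kE] := peirce1_primitive c_prim cP; rewrite kE; congr (_ *: _).
have cc0 := primitive_ip_gt0 c_prim.
have cc_neq0 : ip c c != 0 by rewrite gt_eqF.
apply: (mulIf cc_neq0).
rewrite divfK ?gt_eqF // -(ipZl ipP) -kE (ip_quad_rep ipP) /quad_rep /jsqr !cc.
by rewrite !ipE; ring.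
Qed.

(** For u = P(x)c the fundamental formula gives u^2 = P(x)P(c)x^2 = k u with k >= 0, so u is either
    0 or a positive multiple of a square. *)
Lemma quad_rep_prim_cone x c : primitive_idempotent J c -> K (quad_rep J x c).
Proof.
move=> c_prim; have cc0 := primitive_ip_gt0 c_prim; set u := quad_rep J x c.
pose k := ip (x ∘ x) c / ip c c.
have uu : u ∘ u = k *: u.
  rewrite -quad_rep_unit quad_rep_fundamental quad_rep_unit.
  by rewrite (quad_rep_primitive _ c_prim) quad_repZr.
have k0 : 0 <= k.
  rewrite divr_ge0 ?(ltW cc0) // cone_ip_ge0 //; first exact: cone_sqr.
  exact/cone_idem/primitive_idem.
have [kz|kz] := eqVneq k 0.
  rewrite (_ : u = 0); first exact: cone0.
  apply: (ip_eq0 ipP); rewrite -[X in ip u X](jmul1r J) -(ip_jmulr ipP) uu kz.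
  by rewrite scale0r (ip0l ipP).
rewrite (_ : u = k^-1 *: (u ∘ u)); last by rewrite uu scalerA mulVf ?scale1r.
by apply: coneZ; [rewrite invr_ge0 | exact: cone_sqr].
Qed.

Lemma quad_rep_sumr I (s : seq I) (P : pred I) (F : I -> 'rV[R]_d) x :
  quad_rep J x (\sum_(i <- s | P i) F i) = \sum_(i <- s | P i) quad_rep J x (F
    i).
Proof.
apply: (big_morph _ (quad_repDr J x)).
by rewrite /quad_rep !jmul0r scaler0 subr0.
Qed.

Lemma quad_rep_cone x y : K y -> K (quad_rep J x y).
Proof.
have [r [c [l ycl]]] := spectral_exists ipP y.
move=> /(cone_spectralP ycl) l0; have [[c_prim _ _] ->] := ycl.
rewrite quad_rep_sumr; apply: cone_sum => i _; rewrite quad_repZr.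
by apply: coneZ => //; apply: quad_rep_prim_cone.
Qed.

Lemma quad_rep_cone_pos x x' y : inverse_pair J x x' -> cone_pos y ->
  cone_pos (quad_rep J x y).
Proof.
move=> xx' [eps e0 Ky];
  rewrite -(subrK (eps *: e) y) quad_repDr quad_repZr addrC.
apply: cone_posD; last exact: quad_rep_cone.
apply: cone_posZ => //; rewrite quad_rep_unit.
(* Applying P(x) to C e - x'^2 in the cone gives C x^2 - e in the cone. *)
have [C C0 [_ KC]] := cone_order_unit (x' ∘ x').
exists C^-1; first by rewrite invr_gt0.
have /(coneZ (ltW (_ : 0 < C^-1))) := quad_rep_cone x KC.
rewrite invr_gt0 => /(_ C0).
by rewrite quad_repBr quad_repZr quad_rep_unit xx'.2 scalerBr scalerA mulVf
  ?gt_eqF // scale1r.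
Qed.

Lemma cone_pos_ip_gt0 x y : e != 0 -> cone_pos x -> cone_pos y -> 0 < ip x y.
Proof.
move=> e_neq0 [eps e0 Kx] Py; have [eps' e0' Ky] := Py.
rewrite -(subrK (eps *: e) x) (ipDl ipP) ltr_wpDl //.
  by apply: cone_ip_ge0 => //; apply: cone_pos_cone.
rewrite (ipZl ipP) mulr_gt0 // -(subrK (eps' *: e) y) (ipDr ipP) ltr_wpDl //.
  by apply: cone_ip_ge0 => //; apply: cone_unit.
by rewrite (ipZr ipP) mulr_gt0 // (ip_gt0 ipP).
Qed.

Lemma cone_pos_spectralP x r (c : 'I_r -> 'rV[R]_d) (l : 'I_r -> R) :
  spectral_decomposition J x c l -> cone_pos x <-> forall i, 0 < l i.
Proof.
move=> [c_frame ->]; have [c_prim _ cE] := c_frame.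
have aeE a : a *: e = \sum_i a *: c i by rewrite -scaler_sumr cE.
split=> [[eps e0 Kx] i|l_gt0].
  have : spectral_decomposition J (\sum_i l i *: c i - eps *: e) c (fun i => l
    i - eps).
    split=> //; rewrite aeE -sumrB; by under [RHS]eq_bigr do rewrite scalerBl.
  by move=> /cone_spectralP h; have := h.1 Kx i; lra.
pose D := 1 + \sum_i (l i)^-1;
  have li0 i : 0 <= (l i)^-1 by rewrite invr_ge0 ltW.
have D0 : 0 < D by rewrite ltr_pwDl // sumr_ge0.
exists D^-1; first by rewrite invr_gt0.
rewrite aeE -sumrB; apply: cone_sum => i _; rewrite -scalerBl.
apply: coneZ; last exact/cone_idem/primitive_idem.
rewrite subr_ge0 -[leRHS]invrK lef_pV2 ?posrE ?invr_gt0 //.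
by rewrite /D (bigD1 i) //= addrCA lerDl addr_ge0 // sumr_ge0.
Qed.

End Cone.

(** * The trace form, powers and geometric means *)

Section Trace.
Variables (R : realType) (d : nat) (J : jordanAlgebra R d).
Variable ip : 'rV[R]_d -> 'rV[R]_d -> R.
Hypothesis ipP : associative_ip J ip.
Implicit Types x y z u v w : 'rV[R]_d.

Local Notation "x ∘ y" := (jmul J x y) (at level 40, left associativity).
Local Notation e := (junit J).
Local Notation K := (jcone J).

(* Apply [P(P(c)b) = P(c)P(b)P(c)] to [c], where [P(c)b] and [P(b)c] are
   multiples of [c] and [b]. *)
Lemma primitive_norm_eq b c : primitive_idempotent J b ->
  primitive_idempotent J c ->
  ip b c != 0 -> ip b b = ip c c.
Proof.
move=> b_prim c_prim bc0; have bb0 := primitive_ip_gt0 ipP b_prim.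
have cc0 := primitive_ip_gt0 ipP c_prim.
have Pb x := quad_rep_primitive ipP x b_prim.
have Pc x := quad_rep_primitive ipP x c_prim.
pose k := ip b c / ip c c; pose l := ip b c / ip b b.
have k0 : k != 0 by rewrite mulf_neq0 // invr_neq0 ?gt_eqF.
have kl : k = l.
  have := quad_rep_fundamental J c b c.
  rewrite (Pc b) -/k (Pc c) divff ?gt_eqF // scale1r (Pb c) (ipC ipP c b) -/l.
  rewrite quad_repZr (Pc b) -/k scalerA /quad_rep /jsqr !(jmulZl, jmulZr).
  rewrite !(primitive_idem c_prim) !scalerA => h.
  have {}h : (k * k - l * k) *: c = 0 by rowlra.
  move/eqP: h; rewrite scaler_eq0 -mulrBl mulf_eq0 (negPf k0) orbF subr_eq0.
  by case/orP=> /eqP // c0; rewrite c0 (ip0l ipP) ltxx in cc0.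
by move/(congr1 (fun t => (ip b c / t))): kl;
  rewrite /k /l !invfM !invrK !mulVKf.
Qed.

(** In every nonzero term (c_i, c_i) may be replaced by (b, b), and the sum becomes (b, e) / (b, b)
    = 1. *)
Lemma frame_trace_primitive r (c : 'I_r -> 'rV[R]_d) b : jordan_frame J c ->
  primitive_idempotent J b -> \sum_i ip b (c i) / ip (c i) (c i) = 1.
Proof.
move=> [c_prim _ cE] b_prim; have bb0 := primitive_ip_gt0 ipP b_prim.
transitivity (\sum_i ip b (c i) / ip b b).
  apply: eq_bigr => i _; have [->|bc0] := eqVneq (ip b (c i)) 0;
    first by rewrite !mul0r.
  by rewrite (primitive_norm_eq b_prim (c_prim i) bc0).
rewrite -mulr_suml -(ip_sumr ipP) cE -{1}(primitive_idem b_prim) (ip_jmulr ipP).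
by rewrite jmul1r divff ?gt_eqF.
Qed.

(** The vector that represents the trace with respect to [ip]. *)
Definition frame_weight r (c : 'I_r -> 'rV[R]_d) :=
  \sum_i (ip (c i) (c i))^-1 *: c i.

Lemma frame_weight_trace r (c : 'I_r -> 'rV[R]_d) x s : jordan_frame J c ->
  is_trace J x s -> s = ip x (frame_weight c).
Proof.
move=> c_frame [q [b [l [[b_frame ->] ->]]]]; rewrite (ip_suml ipP).
apply: eq_bigr => j _; rewrite (ipZl ipP) -[LHS]mulr1; congr (_ * _).
have [b_prim _ _] := b_frame;
  rewrite -(frame_trace_primitive c_frame (b_prim j)).
by rewrite (ip_sumr ipP); apply: eq_bigr => i _; rewrite (ipZr ipP) mulrC.
Qed.

Lemma jtr_weight r (c : 'I_r -> 'rV[R]_d) x : jordan_frame J c ->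
  jtr J x = ip x (frame_weight c).
Proof.
move=> c_frame; apply: (frame_weight_trace c_frame); apply: xgetPex.
have [q [b [l xbl]]] := spectral_exists ipP x.
by exists (\sum_j l j), q, b, l.
Qed.

Lemma jtr_spectral x r (c : 'I_r -> 'rV[R]_d) (l : 'I_r -> R) :
  spectral_decomposition J x c l -> jtr J x = \sum_i l i.
Proof.
move=> xcl; have [c_frame _] := xcl; rewrite (jtr_weight _ c_frame).
by apply/esym/(frame_weight_trace c_frame); exists r, c, l.
Qed.

(* The weight does not depend on the frame, so it can be computed in a frame
   diagonalizing [x]. *)
Lemma frame_weight_central r (c : 'I_r -> 'rV[R]_d) x y : jordan_frame J c ->
  frame_weight c ∘ (x ∘ y) = x ∘ (frame_weight c ∘ y).
Proof.
move=> c_frame; have [q [b [l [b_frame xE]]]] := spectral_exists ipP x.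
have -> : frame_weight c = frame_weight b.
  apply: (ip_ext ipP) => z; rewrite !(ipC ipP _ z).
  by rewrite -(jtr_weight _ c_frame) -(jtr_weight _ b_frame).
have [b_prim b_orth _] := b_frame.
have bb i j : b i ∘ (b j ∘ y) = b j ∘ (b i ∘ y).
  have [-> //|ij] := eqVneq i j.
  by apply: orth_idem_comm; [exact: primitive_idem | exact: b_orth].
rewrite /frame_weight xE !jmul_suml; under eq_bigr do rewrite jmul_sumr.
under [RHS]eq_bigr do rewrite jmul_sumr.
rewrite exchange_big; apply: eq_bigr => i _; apply: eq_bigr => j _.
by rewrite !(jmulZl, jmulZr) bb !scalerA mulrC.
Qed.

(** Linearity comes from representing the trace by the weight, positivity from tr(x^2) being the sum
    of the squared eigenvalues, and associativity from the weight being central. *)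
Theorem jdot_associative_ip : associative_ip J (jdot J).
Proof.
have [r [c [_ [c_frame _]]]] := spectral_exists ipP 0.
have dotE x y : jdot J x y = ip (x ∘ y) (frame_weight c) by apply: jtr_weight.
split.
- by move=> y a u v; rewrite !dotE jmulDl jmulZl (ipDl ipP) (ipZl ipP).
- by move=> x y; rewrite /jdot jmulC.
- move=> x x0; have [q [b [l xbl]]] := spectral_exists ipP x.
  have [b_frame xE] := xbl; have xxE : x ∘ x = \sum_i (l i * l i) *: b i.
    by rewrite {1 2}xE frame_jmul.
  rewrite /jdot (@jtr_spectral _ _ b (fun i => l i * l i)) //.
  have ll i : 0 <= l i * l i by rewrite -expr2 sqr_ge0.
  rewrite lt0r sumr_ge0 // andbT; apply: contra_neq x0 => /eqP.
  rewrite psumr_eq0 // => /allP h; rewrite xE big1 // => i _.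
  have := h i; rewrite mem_index_enum => /(_ isT) /=.
  by rewrite mulf_eq0 orbb => /eqP ->; rewrite scale0r.
- move=> x y z; rewrite !dotE (jmulC J x y) !(ip_jmulr ipP).
  by rewrite ![_ ∘ frame_weight c]jmulC frame_weight_central.
Qed.

End Trace.

Section Powers.
Variables (R : realType) (d : nat) (J : jordanAlgebra R d).
Variable ip : 'rV[R]_d -> 'rV[R]_d -> R.
Hypothesis ipP : associative_ip J ip.
Implicit Types x y z u v w : 'rV[R]_d.

Local Notation "x ∘ y" := (jmul J x y) (at level 40, left associativity).
Local Notation e := (junit J).
Local Notation K := (jcone J).

(** Since c_i ∘ b_j = 0 unless l_i = m_j, both sides expand to the double sum of f(l_i) c_i ∘
    b_j. *)
Lemma functional_calculus_uniq x r (c : 'I_r -> 'rV[R]_d) l q (b : 'I_q ->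
  'rV[R]_d) m
    (f : R -> R) :
  spectral_decomposition J x c l -> spectral_decomposition J x b m ->
  \sum_i f (l i) *: c i = \sum_j f (m j) *: b j.
Proof.
move=> [c_frame xc] [b_frame xb].
have [c_prim _ cE] := c_frame; have [b_prim _ bE] := b_frame.
have cc i := primitive_idem (c_prim i); have bb j := primitive_idem (b_prim j).
have eig q' (a : 'I_q' -> 'rV[R]_d) k i : jordan_frame J a ->
    (\sum_j k j *: a j) ∘ a i = k i *: a i.
  move=> [a_prim a_orth _];
    rewrite jmul_suml (bigD1 i) //= big1 ?addr0 => [|j ji].
    by rewrite jmulZl primitive_idem.
  by rewrite jmulZl a_orth ?scaler0.
have cb i j : l i != m j -> c i ∘ b j = 0.
  move=> lm; apply: (idem_ip_eq0 ipP) => //.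
  have : ip (x ∘ c i) (b j) = ip (c i) (x ∘ b j) by rewrite (ip_jmul ipP).
  rewrite {1}xc xb !eig // (ipZl ipP) (ipZr ipP) => /eqP.
  by rewrite -subr_eq0 -mulrBl mulf_eq0 subr_eq0 (negPf lm) => /eqP.
transitivity (\sum_i \sum_j f (l i) *: (c i ∘ b j)).
  by apply: eq_bigr => i _; rewrite -scaler_sumr -jmul_sumr bE jmul1r.
rewrite exchange_big; apply: eq_bigr => j _.
rewrite -[in RHS](jmul1 J (b j)) -cE jmul_suml scaler_sumr;
  apply: eq_bigr => i _.
by have [-> //|/cb ->] := eqVneq (l i) (m j); rewrite !scaler0.
Qed.

Lemma is_jpow_uniq x al y y' : is_jpow J x al y -> is_jpow J x al y' -> y = y'.
Proof.
move=> [r [c [l [xcl _ ->]]]] [q [b [m [xbm _ ->]]]].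
exact: (functional_calculus_uniq (fun t => rpow t al) xcl xbm).
Qed.

Lemma jpowE x al r (c : 'I_r -> 'rV[R]_d) l : spectral_decomposition J x c l ->
  (forall i, 0 < l i) ->
  jpow_defined J x al /\ jpow J x al = \sum_i l i `^ al *: c i.
Proof.
move=> xcl l0; have h : is_jpow J x al (\sum_i l i `^ al *: c i).
  exists r, c, l; split=> // [i|]; first exact: Or31.
  by apply: eq_bigr => i _; rewrite /rpow ltW.
split; first by exists (\sum_i l i `^ al *: c i);
  split=> // y /(is_jpow_uniq h).
by apply: (@is_jpow_uniq x al) => //; apply: xgetPex; eexists; exact: h.
Qed.

Lemma frame_quad_rep r (c : 'I_r -> 'rV[R]_d) (h k : 'I_r -> R) : jordan_frame
  J c ->
  quad_rep J (\sum_i h i *: c i) (\sum_i k i *: c i) =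
  \sum_i (h i * h i * k i) *: c i.
Proof.
move=> c_frame; rewrite /quad_rep /jsqr !frame_jmul // scaler_sumr -sumrB.
apply: eq_bigr => i _; rewrite scalerA -scalerBl; congr (_ *: _); ring.
Qed.

Lemma frame_inverse_pair r (c : 'I_r -> 'rV[R]_d) (h k : 'I_r -> R) :
  jordan_frame J c -> (forall i, h i * k i = 1) ->
  inverse_pair J (\sum_i h i *: c i) (\sum_i k i *: c i).
Proof.
move=> c_frame hk; have [_ _ cE] := c_frame.
split; rewrite ?frame_jmul // frame_quad_rep //; last rewrite -cE.
  by apply: eq_bigr => i _; rewrite -mulrA hk mulr1.
by apply: eq_bigr => i _;
  rewrite -mulrA (mulrA (h i) (k i)) hk mul1r hk scale1r.
Qed.

Lemma cone_pos_frame x : cone_pos J x -> exists r (c : 'I_r -> 'rV[R]_d) l,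
  spectral_decomposition J x c l /\ forall i, 0 < l i.
Proof.
have [r [c [l xcl]]] := spectral_exists ipP x => x_pos.
by exists r, c, l; split=> //; apply/(cone_pos_spectralP ipP xcl).
Qed.

Lemma cone_pos_jpow_defined x al : cone_pos J x -> jpow_defined J x al.
Proof. by move=> /cone_pos_frame[r [c [l [xcl l0]]]];
  case: (jpowE al xcl l0). Qed.

Lemma cone_pos_jpow x al : cone_pos J x -> cone_pos J (jpow J x al).
Proof.
move=> /cone_pos_frame[r [c [l [xcl l0]]]]; have [_ ->] := jpowE al xcl l0.
apply/(cone_pos_spectralP ipP (c := c) (l := fun i => l i `^ al)).
  by case: xcl.
by move=> i; rewrite powR_gt0.
Qed.

Lemma jpow_half_sqr x : cone_pos J x -> jpow J x (1 / 2) ∘ jpow J x (1 / 2) = x.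
Proof.
move=> /cone_pos_frame[r [c [l [xcl l0]]]]; have [_ ->] := jpowE (1 / 2) xcl l0.
have [c_frame ->] := xcl; rewrite frame_jmul //; apply: eq_bigr => i _.
rewrite -powRD; last by rewrite (gt_eqF (l0 i)) implybT.
by rewrite (_ : 1 / 2 + 1 / 2 = 1) ?powRr1 ?ltW //; field.
Qed.

Lemma jpow_opp_inverse x al : cone_pos J x ->
  inverse_pair J (jpow J x al) (jpow J x (- al)).
Proof.
move=> /cone_pos_frame[r [c [l [xcl l0]]]].
have [_ ->] := jpowE al xcl l0; have [_ ->] := jpowE (- al) xcl l0.
apply: frame_inverse_pair => [|i]; first by case: xcl.
by rewrite powRN mulfV // gt_eqF // powR_gt0.
Qed.

Lemma jpow1 x : cone_pos J x -> jpow J x 1 = x.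
Proof.
move=> /cone_pos_frame[r [c [l [xcl l0]]]]; have [_ ->] := jpowE 1 xcl l0.
by have [_ ->] := xcl; apply: eq_bigr => i _; rewrite powRr1 // ltW.
Qed.

Lemma jpow_inverse x : cone_pos J x -> inverse_pair J x (jpow J x (- 1)).
Proof. by move=> x_pos; rewrite -{1}(jpow1 x_pos); apply: jpow_opp_inverse. Qed.

Lemma geomean_pos a b : cone_pos J a -> cone_pos J b ->
  geomean_defined J a b /\ cone_pos J (geomean J a b).
Proof.
move=> a_pos b_pos; have ss' := jpow_opp_inverse (1 / 2) a_pos.
have q_pos := quad_rep_cone_pos ipP (inverse_pair_sym ss') b_pos.
split; first by split; try exact/(cone_posP ipP); exact: cone_pos_jpow_defined.
by apply: (quad_rep_cone_pos ipP ss'); exact: cone_pos_jpow.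
Qed.

(** With s = a^(1/2), q = P(s^-1)b and r = q^(1/2), the inverse of q is P(s)z, so P(r)P(s)z = e.
    Hence P(P(s)r)z = P(s)P(r)P(s)z = P(s)e = a. *)
Lemma geomean_riccati a b z : cone_pos J a -> cone_pos J b ->
  inverse_pair J z b ->
  quad_rep J (geomean J a b) z = a.
Proof.
move=> a_pos b_pos zb; rewrite /geomean.
have ss' := jpow_opp_inverse (1 / 2) a_pos.
have sE := jpow_half_sqr a_pos.
set s := jpow J a (1 / 2) in ss' sE *; set s' := jpow J a (- (1 / 2)) in ss' *.
set q := quad_rep J s' b; have q_pos : cone_pos J q.
  by have := quad_rep_cone_pos ipP (inverse_pair_sym ss') b_pos.
have rr' := jpow_opp_inverse (1 / 2) q_pos.
have rE := jpow_half_sqr q_pos; set r := jpow J q (1 / 2) in rr' rE *.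
have qz : inverse_pair J q (quad_rep J s z).
  exact: inverse_pair_quad_rep (inverse_pair_sym ss') (inverse_pair_sym zb).
have h := qz.1; rewrite -{1 2}rE quad_rep_sqr -quad_rep_unit in h.
have Pr := congr1 (quad_rep J (jpow J q (- (1 / 2)))) h.
rewrite !(inverse_pair_quad _ rr').2 in Pr.
by rewrite quad_rep_fundamental Pr quad_rep_unit.
Qed.

End Powers.

(** * Majorization *)

Lemma quadratic_form_discr (R : realFieldType) (a g b : R) :
  (forall s t, 0 <= a * s ^+ 2 + 2 * g * s * t + b * t ^+ 2) -> g ^+ 2 <= a * b.
Proof.
move=> h; have b0 : 0 <= b by have := h 0 1; rewrite expr0n expr1n /=; lra.
have [bz|bn0] := eqVneq b 0.
  rewrite bz mulr0; have [->|gn0] := eqVneq g 0; first by rewrite expr0n.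
  (* At this point the form would take the value -1. *)
  have := h 1 (- (a + 1) / (2 * g)); rewrite bz mul0r addr0 expr1n !mulr1.
  by rewrite mulrC divfK ?mulf_neq0 ?pnatr_eq0 //; lra.
have b_gt0 : 0 < b by rewrite lt0r bn0.
rewrite -(ler_pM2l b_gt0) -subr_ge0; have := h b (- g); congr (_ <= _); ring.
Qed.

Section Perron.
Variables (R : realType) (d : nat) (J : jordanAlgebra R d).
Variable ip : 'rV[R]_d -> 'rV[R]_d -> R.
Hypothesis ipP : associative_ip J ip.
Implicit Types x y z u v w : 'rV[R]_d.

Local Notation "x ∘ y" := (jmul J x y) (at level 40, left associativity).
Local Notation e := (junit J).
Local Notation K := (jcone J).

Let ipE := (ipDl ipP, ipDr ipP, ipBl ipP, ipBr ipP, ipNl ipP, ipNr ipP,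
  ipZl ipP, ipZr ipP).

(* A cone-preserving positive semidefinite operator with an interior fixed point
   is at most the identity: otherwise its iterates at [y] grow, although the
   order unit [a] bounds them. *)
Lemma perron_le (k : nat) (u : 'I_k -> 'rV[R]_d) a y :
  (forall i, K (u i)) -> cone_pos J a -> \sum_i ip (u i) a *: u i = a ->
  \sum_i ip (u i) y ^+ 2 <= ip y y.
Proof.
move=> Ku a_pos aE; pose Q x := \sum_i ip (u i) x *: u i.
have QE x z : ip (Q x) z = \sum_i ip (u i) x * ip (u i) z.
  by rewrite (ip_suml ipP); apply: eq_bigr => i _; rewrite (ipZl ipP).
have Qxx x : ip (Q x) x = \sum_i ip (u i) x ^+ 2.
  by rewrite QE; apply: eq_bigr => i _; rewrite expr2.
have QD s t x z : Q (s *: x + t *: z) = s *: Q x + t *: Q z.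
  rewrite /Q !scaler_sumr -big_split; apply: eq_bigr => i _ /=.
  by rewrite !ipE !scalerA -scalerDl.
have QC x z : ip (Q x) z = ip (Q z) x.
  by rewrite !QE; apply: eq_bigr => i _; rewrite mulrC.
have Q_ge0 x : 0 <= ip (Q x) x by rewrite Qxx sumr_ge0 // => i _;
  rewrite sqr_ge0.
have QK x : K x -> K (Q x).
  move=> Kx; apply: (cone_sum ipP) => i _; apply: (coneZ ipP) => //.
  exact: (cone_ip_ge0 ipP).
have CS1 x z : ip x z ^+ 2 <= ip x x * ip z z.
  apply: quadratic_form_discr => s t.
  have := ip_ge0 ipP (s *: x + t *: z); rewrite !ipE (ipC ipP z x).
  by congr (_ <= _); ring.
have CS2 x z : ip (Q x) z ^+ 2 <= ip (Q x) x * ip (Q z) z.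
  apply: quadratic_form_discr => s t.
  have := Q_ge0 (s *: x + t *: z); rewrite QD !ipE (QC z x).
  by congr (_ <= _); ring.
rewrite -Qxx leNgt; apply/negP => lt_y.
have y_pos : 0 < ip y y.
  rewrite lt0r (ip_ge0 ipP) andbT; apply: contraTneq lt_y => /(ip_eq0 ipP) ->.
  by rewrite !(ip0r ipP) ltxx.
(* The Rayleigh quotient of y. By the two Cauchy-Schwarz inequalities, for [ip] and for the form of
   Q, applying Q keeps the quotient at least rho. *)
pose rho := ip (Q y) y / ip y y.
have rho1 : 1 < rho by rewrite ltr_pdivlMr // mul1r.
have step x : 0 < ip x x -> rho * ip x x <= ip (Q x) x ->
    rho * ip x x <= ip (Q x) (Q x) /\ rho * ip (Q x) (Q x) <= ip (Q (Q x)) (Q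
      x).
  have := CS1 (Q x) x; have := CS2 x (Q x).
  set al := ip x x; set g := ip (Q x) x; set n := ip (Q x) (Q x).
  set h := ip (Q (Q x)) (Q x) => c2 c1 al0 gal.
  have rho0 : 0 < rho by apply: lt_trans rho1.
  have g0 : 0 < g by apply: lt_le_trans gal; rewrite mulr_gt0.
  have ng : rho * g <= n.
    by rewrite -(ler_pM2r al0); apply: le_trans c1;
      rewrite expr2 mulrAC ler_wpM2r // ltW.
  have n0 : 0 < n by apply: lt_le_trans ng; rewrite mulr_gt0.
  split; first by apply: le_trans ng; apply: le_trans gal _;
    rewrite ler_peMl // ltW.
  rewrite -(ler_pM2l g0); apply: le_trans c2.
  by rewrite expr2 mulrCA mulrA ler_wpM2r // ltW.
pose yn n := iter n Q y.
(* Linear growth suffices to contradict a uniform bound by the Archimedean property. *)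
have yn_grow n : [/\ ip y y * (1 + n%:R * (rho - 1)) <= ip (yn n) (yn n),
    ip y y <= ip (yn n) (yn n) & rho * ip (yn n) (yn n) <= ip (Q (yn n)) (yn
      n)].
  elim: n => [|n [h1 h2 h3]].
    by rewrite mul0r addr0 mulr1 /yn /= /rho divfK ?gt_eqF.
  have [s1 s2] := step _ (lt_le_trans y_pos h2) h3.
  have growth : ip (yn n) (yn n) + (rho - 1) * ip y y <= ip (yn n.+1) (yn n.+1).
    apply: le_trans s1.
    have r0 : 0 <= rho - 1 by rewrite subr_ge0 ltW.
    rewrite -subr_ge0 in h2; have := mulr_ge0 r0 h2.
    lra.
  split=> //.
    by rewrite -natr1; apply: le_trans growth; lra.
  apply: le_trans growth; apply: le_trans h2 _;
    rewrite lerDl mulr_ge0 ?(ltW y_pos) //.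
  by rewrite subr_ge0 ltW.
have [C C0 [Kp Km]] := cone_pos_order_unit ipP y a_pos.
have yn_cone n : K (C *: a + yn n) /\ K (C *: a - yn n).
  elim: n => [//|n [h1 h2]]; split.
    by have := QK _ h1; rewrite -[yn n]scale1r QD /Q aE scale1r.
  by have := QK _ h2; rewrite -[yn n]scale1r -scaleNr QD /Q aE scaleN1r.
(* Pair the two cone elements C a + y_n and C a - y_n. *)
have yn_bound n : ip (yn n) (yn n) <= C ^+ 2 * ip a a.
  have [h1 h2] := yn_cone n; have := cone_ip_ge0 ipP h1 h2.
  by rewrite !ipE (ipC ipP (yn n) a); lra.
have M0 : 0 <= C ^+ 2 * ip a a / ip y y / (rho - 1).
  by rewrite !mulr_ge0 ?invr_ge0 ?sqr_ge0 ?(ip_ge0 ipP) ?subr_ge0 ?ltW.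
have := archi_boundP M0; set N := Num.bound _ => ltN.
have [h _ _] := yn_grow N; have := le_trans h (yn_bound N).
rewrite ltr_pdivrMr ?subr_gt0 // ltr_pdivrMr // in ltN.
lra.
Qed.

Lemma least_squares_step (k : nat) (u : 'I_k -> 'rV[R]_d) (v : 'I_k -> R) a w :
  (forall i, K (u i)) -> cone_pos J a -> cone_pos J w ->
  quad_rep J w (\sum_i ip (u i) a *: u i) = a ->
  let a' := quad_rep J w (\sum_i v i *: u i) in
  \sum_i (v i - ip (u i) a') ^+ 2 <= \sum_i (v i - ip (u i) a) ^+ 2.
Proof.
move=> Ku a_pos w_pos; set z := \sum_i ip (u i) a *: u i => wz /=.
set g := \sum_i v i *: u i; set a' := quad_rep J w g; pose D := a' - a.
have hh := jpow_opp_inverse ipP (1 / 2) w_pos.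
have hE := jpow_half_sqr ipP w_pos.
set h := jpow J w (1 / 2) in hh hE; set h' := jpow J w (- (1 / 2)) in hh.
have hh'K x : quad_rep J h (quad_rep J h' x) = x := (inverse_pair_quad x hh).1.
have h'hK x : quad_rep J h' (quad_rep J h x) = x := (inverse_pair_quad x hh).2.
have wE x : quad_rep J w x = quad_rep J h (quad_rep J h x).
  by rewrite -hE quad_rep_sqr.
have DE : D = quad_rep J w (g - z) by rewrite quad_repBr wz.
(* [perron_le] is used for the vectors P(h)u_i, whose operator fixes P(h')a because P(w)z = a. Since
   D = P(w)(g - z), the right-hand side is the squared norm of P(h')D. *)
have majorized : \sum_i ip (u i) D ^+ 2 <= ip D (g - z).
  have := @perron_le k (fun i => quad_rep J h (u i)) (quad_rep J h' a)
    (quad_rep J h' D).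
  have ->: \sum_i ip (quad_rep J h (u i)) (quad_rep J h' D) ^+ 2 =
      \sum_i ip (u i) D ^+ 2.
    by apply: eq_bigr => i _; rewrite (ip_quad_rep ipP) hh'K.
  have -> : ip (quad_rep J h' D) (quad_rep J h' D) = ip D (g - z).
    by rewrite {2}DE wE h'hK (ip_quad_rep ipP) h'hK.
  apply.
  - by move=> i; apply: (quad_rep_cone ipP).
  - exact: (quad_rep_cone_pos ipP (inverse_pair_sym hh)).
  - rewrite -{2}wz wE h'hK /z (quad_rep_sumr J); apply: eq_bigr => i _.
    by rewrite quad_repZr (ip_quad_rep ipP) hh'K.
have cross : \sum_i (v i - ip (u i) a) * ip (u i) D = ip D (g - z).
  rewrite /g /z -sumrB (ip_sumr ipP); apply: eq_bigr => i _.
  by rewrite -scalerBl (ipZr ipP) (ipC ipP D).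
have D_ge0 : 0 <= ip D (g - z).
  by apply: le_trans majorized; rewrite sumr_ge0 // => i _; rewrite sqr_ge0.
have -> : \sum_i (v i - ip (u i) a') ^+ 2 = \sum_i (v i - ip (u i) a) ^+ 2
    - 2 * ip D (g - z) + \sum_i ip (u i) D ^+ 2.
  rewrite -cross mulr_sumr -sumrB -big_split /=; apply: eq_bigr => i _.
  by rewrite -(subrK a a') -/D (ipDr ipP); ring.
lra.
Qed.

Lemma cone_pos_sum (k : nat) (u : 'I_k -> 'rV[R]_d) (v : 'I_k -> R) i :
  (forall j, cone_pos J (u j)) -> (forall j, 0 <= v j) -> 0 < v i ->
  cone_pos J (\sum_j v j *: u j).
Proof.
move=> u_pos v0 vi; rewrite (bigD1 i) //=; apply: (cone_posD ipP).
  exact: (cone_posZ ipP).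
apply: (cone_sum ipP) => j _; apply: (coneZ ipP) => //.
exact: (cone_pos_cone ipP).
Qed.

End Perron.

(** * One vector update, and descent along the whole iteration *)

Section Update.
Variables (R : realType) (d : nat) (J : jordanAlgebra R d).
Hypothesis J_euclidean : euclidean J.

Lemma scmu_update_spec (k : nat) (u : 'I_k -> 'rV[R]_d) (a : 'rV[R]_d)
    (v : 'rV[R]_k) :
  (forall i, cone_pos J (u i)) -> cone_pos J a ->
  (forall i, 0 <= v 0 i) -> v != 0 ->
  [/\ scmu_update_defined J u a, cone_pos J (scmu_update J u a v)
    & \sum_i (v 0 i - jdot J (u i) (scmu_update J u a v)) ^+ 2 <=
      \sum_i (v 0 i - jdot J (u i) a) ^+ 2].
Proof.
move=> u_pos a_pos v0 vn0; have [ip0 ip0P] := J_euclidean.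
have ipP : associative_ip J (jdot J) := jdot_associative_ip ip0P.
have [i vi] : exists i, 0 < v 0 i.
  have /rV0Pn[i vi] := vn0; by exists i; rewrite lt0r vi v0.
have zE : fam_adj u (fam_op J u a) = \sum_i jdot J (u i) a *: u i.
  by apply: eq_bigr => j _; rewrite mxE.
have z_pos : cone_pos J (fam_adj u (fam_op J u a)).
  (* In the zero algebra all pairings vanish, but z is trivially interior. Otherwise all pairings of
     interior points are positive, and the index i makes the sum nonempty. *)
  have [e0|e0] := eqVneq (junit J) 0.
    exists 1 => //; rewrite -[_ - _](jmul1 J) e0 jmul0l; exact: (cone0 ipP).
  have dot_gt0 j : 0 < jdot J (u j) a by apply: (cone_pos_ip_gt0 ipP).
  by rewrite zE; apply: (cone_pos_sum ipP (i := i)) => // j; apply: ltW.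
have zi := jpow_inverse ipP z_pos; have zi_pos := cone_pos_jpow ipP (- 1) z_pos.
have [gm_def gm_pos] := geomean_pos ipP a_pos zi_pos.
have [w' ww'] : exists w', inverse_pair J (geomean J a (jpow J (fam_adj u
  (fam_op J u a)) (- 1))) w'.
  by eexists; apply: (jpow_inverse ipP gm_pos).
have wz := geomean_riccati ipP a_pos zi_pos zi.
split; first by split=> //; apply: (cone_pos_jpow_defined ipP).
  apply: (quad_rep_cone_pos ipP ww'); exact: (cone_pos_sum ipP (i := i)).
apply: (least_squares_step ipP) => //; last by rewrite -zE.
by move=> j; apply: (cone_pos_cone ipP).
Qed.

End Update.

Theorem mainTheorem2 (R : realType) (d : nat) (J : jordanAlgebra R d)
    (m n : nat) (X : 'M[R]_(m, n))
    (a0 : 'I_m -> 'rV[R]_d) (b0 : 'I_n -> 'rV[R]_d)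
    (J_euclidean : euclidean J)
    (X_ge0 : forall i j, 0 <= X i j)
    (X_row : forall i, row i X != 0)
    (X_col : forall j, col j X != 0)
    (a0_int : forall i, interior (jcone J) (a0 i))
    (b0_int : forall j, interior (jcone J) (b0 j)) :
  let a (t : nat) : 'I_m -> 'rV[R]_d := (scmu J X a0 b0 t).1 in
  let b (t : nat) : 'I_n -> 'rV[R]_d := (scmu J X a0 b0 t).2 in
  forall t : nat,
    [/\ forall i, scmu_update_defined J (b t) (a t i),
        forall j, scmu_update_defined J (a t.+1) (b t j),
        forall i, interior (jcone J) (a t i),
        forall j, interior (jcone J) (b t j)
      & sq_loss J X (a t.+1) (b t.+1) <= sq_loss J X (a t) (b t)].
Proof.
move=> a b; have [ip ipP] := J_euclidean; have intP := cone_posP ipP.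
have row_ge0 i j : 0 <= row i X 0 j by rewrite mxE.
have col_ge0 j i : 0 <= (col j X)^T 0 i by rewrite !mxE.
have col_neq0 j : (col j X)^T != 0 by rewrite trmx_eq0.
have a_step t i : a t.+1 i = scmu_update J (b t) (a t i) (row i X) by [].
have b_step t j : b t.+1 j = scmu_update J (a t.+1) (b t j) (col j X)^T by [].
have row_spec t i (bt : forall j, cone_pos J (b t j)) (at_ : cone_pos J (a t
  i)) :=
  scmu_update_spec J_euclidean bt at_ (row_ge0 i) (X_row i).
have col_spec t j (at1 : forall i, cone_pos J (a t.+1 i)) (bt : cone_pos J (b t
  j)) :=
  scmu_update_spec J_euclidean at1 bt (col_ge0 j) (col_neq0 j).
have pos t : (forall i, cone_pos J (a t i)) /\ (forall j, cone_pos J (b t j)).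
  elim: t => [|t [at_ bt]]; first by split=> i; apply/intP.
  have at1 i : cone_pos J (a t.+1 i) by case: (row_spec t i bt (at_ i)).
  by split=> // j; case: (col_spec t j at1 (bt j)).
move=> t; have [at_ bt] := pos t; have [at1 _] := pos t.+1.
split.
- by move=> i; case: (row_spec t i bt (at_ i)).
- by move=> j; case: (col_spec t j at1 (bt j)).
- by move=> i; apply/intP.
- by move=> j; apply/intP.
have jdotC x y : jdot J x y = jdot J y x by rewrite /jdot jmulC.
(* The intermediate loss has new a and old b. For fixed a it separates into one least-squares
   problem per column, and for fixed b the loss separates by rows. *)
apply: (@le_trans _ _ (sq_loss J X (a t.+1) (b t))).
  rewrite /sq_loss exchange_big [leRHS]exchange_big; apply: ler_sum => j _.
  have [_ _] := col_spec t j at1 (bt j); rewrite -b_step.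
  by congr (_ <= _); apply: eq_bigr => i _; rewrite !mxE.
apply: ler_sum => i _; have [_ _] := row_spec t i bt (at_ i); rewrite -a_step.
by congr (_ <= _); apply: eq_bigr => j _; rewrite mxE jdotC.
Qed.
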